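(* The Boole map $T(x) = x - \frac{1}{x}$ is global-local mixing with respect to the Lebesgue measure $m$ on $\mathbb{R}$. That is, for every global observable $F$ and every local observable $g$, $$\lim_{n \to \infty} \int_{\mathbb{R}} (F \circ T^n)\, g \, dm = \overline{m}(F) \int_{\mathbb{R}} g \, dm .$$
   Context: $m$ is the Lebesgue measure on $\mathbb{R}$. The Boole map is $T(x) := x - \frac{1}{x}$; it is defined for $x \neq 0$, so each iterate $T^n$ is defined outside a countable, hence $m$-null, set. A global observable is any (complex-valued) $F \in L^\infty(\mathbb{R}, m)$ for which the limit $\overline{m}(F) := \lim_{a \to +\infty} \frac{1}{2a} \int_{-a}^{a} F \, dm$ exists; $\overline{m}(F)$ is called the infinite-volume average of $F$. A local observable is any $g \in L^1(\mathbb{R}, m)$. *)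

(* Defs.v *)
From HB Require Import structures.
From mathcomp Require Import all_boot all_order all_algebra.
From mathcomp Require Import all_classical all_reals all_analysis.
From mathcomp Require Import complex.

Set Implicit Arguments.
Unset Strict Implicit.
Unset Printing Implicit Defensive.

Import Order.TTheory GRing.Theory Num.Theory.
Import numFieldNormedType.Exports.

Local Open Scope classical_set_scope.
Local Open Scope ring_scope.
Local Open Scope complex_scope.

(** The instances of [numFieldNormedType] on [numClosedFieldType]s are not found
    by unification on [R[i]]; these copies give [R[i]] the same topology, the one
    induced by the complex modulus. *)
#[export, non_forgetful_inheritance]
HB.instance Definition _ (R : realType) :=
  PseudoPointedMetric.copy R[i] R[i]^o.
#[export, non_forgetful_inheritance]
HB.instance Definition _ (R : realType) :=
  NormedModule.copy R[i] R[i]^o.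

Section complex_lebesgue.
Context d (T : measurableType d) (R : realType).
Variable mu : {measure set T -> \bar R}.

(** Functions representing the elements of the complex [L^p] space. Borel
    measurability into [R[i]] amounts to measurability of both coordinates; the
    last clause bounds the library's [L^p] norm of the modulus [|f|], which for
    [p = +oo] is its essential supremum. *)
Definition complex_Lfun (p : \bar R) (f : T -> R[i]) : Prop :=
  [/\ measurable_fun [set: T] (fun x => complex.Re (f x)),
      measurable_fun [set: T] (fun x => complex.Im (f x))
    & finite_norm mu p (fun x => Normc.normc (f x))].

(** Only meaningful when the modulus of [f] is integrable on [D]. *)
Definition complex_integral (D : set T) (f : T -> R[i]) : R[i] :=
  (\int[mu]_(x in D) complex.Re (f x)) +i* (\int[mu]_(x in D) complex.Im (f x)).

End complex_lebesgue.

Section observables.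
Context {R : realType}.

Local Notation m := (@lebesgue_measure R).

Definition volume_average (F : R -> R[i]) (a : R) : R[i] :=
  ((2 * a)^-1)%:C * complex_integral m `[- a, a] F.

Definition global_observable (F : R -> R[i]) : Prop :=
  complex_Lfun m +oo%E F /\ cvg (volume_average F a @[a --> +oo]).

(** A junk value when the limit does not exist. *)
Definition infinite_volume_average (F : R -> R[i]) : R[i] :=
  lim (volume_average F a @[a --> +oo]).

Definition local_observable (g : R -> R[i]) : Prop := complex_Lfun m 1%E g.

Definition global_local_mixing (T : R -> R) : Prop :=
  forall F g : R -> R[i], global_observable F -> local_observable g ->
    complex_integral m setT (fun x => F (iter n T x) * g x) @[n --> \oo]
      --> infinite_volume_average F * complex_integral m setT g.

(** Total, with [boole_map 0 = 0] because [0^-1 = 0]; this changes each iterate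
    only on the countable set of preimages of [0], which is [m]-null. *)
Definition boole_map (x : R) : R := x - x^-1.

End observables.

(* Main.v *)
Require Import Defs.
From HB Require Import structures.
From mathcomp Require Import all_boot all_order all_algebra.
From mathcomp Require Import all_classical all_reals all_analysis.
From mathcomp Require Import measurable_realfun ess_sup_inf complex ring lra.

Set Implicit Arguments.
Unset Strict Implicit.
Unset Printing Implicit Defensive.

Import Order.TTheory GRing.Theory Num.Theory.
Import numFieldNormedType.Exports.

Local Open Scope classical_set_scope.
Local Open Scope ring_scope.

(** The Boole map [T x = x - 1/x] is the boundary restriction of the holomorphic
    map [w |-> w - 1/w] of the upper half-plane into itself.  Let [C_w] be the
    Cauchy density (Poisson kernel) with location [Re w] and scale [Im w].
    Because [T] is an inner function, the image under [T] of the measure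
    [C_w dm] is [C_(T w) dm].  Hence, for a nonnegative measurable [F],
      [int (F o T^n) C_w dm = int F C_(T^n w) dm]
    ([ge0_integral_iter_boole_cauchy]).

    The orbit of a point [w = u + i v] is easy to control: the imaginary part
    increases to [+oo] ([iter_boole_hp_cvgy]) while the real part stays bounded
    by [max |u| (1/v)] ([iter_boole_hp_re_le]).  So [C_(T^n w)] becomes
    asymptotically, in [L^1], a centred Cauchy density of scale tending to
    [+oo]; such a density is a mixture of uniform distributions on intervals
    [[-a, a]], in which each bounded range of [a] has vanishing weight, so the
    integral of [F] against it tends to the infinite-volume average of [F]
    ([cauchy_average]).  This gives the theorem when the local observable is a
    Cauchy density ([cvg_boole_cauchy]).

    For a fixed bounded [F >= 0], the local observables for which the limit
    holds form a closed subspace of [L^1].  It contains the averages of [C_w]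
    over [w] in a horizontal segment; when the height of the segment tends to
    [0], these averages converge in [L^1] to the indicator of an interval, and
    indicators of intervals span a dense subspace of [L^1]
    ([cvg_weak_integrable]).

    A complex essentially bounded [F] is reduced to this case by treating real
    and imaginary parts separately, changing [F] on a null set, which is
    harmless as [T] is nonsingular ([ae_comp_iter_boole]), and adding a
    constant. *)

(** * Measurability and integrability *)

Section integrability.
Context d (T : measurableType d) (R : realType).
Variable mu : {measure set T -> \bar R}.

Lemma integrable_bounded_mul (D : set T) (f g : T -> R) (M : R) :
  measurable D ->
  measurable_fun D f -> (forall x, `|f x| <= M) ->
  mu.-integrable D (EFin \o g) ->
  mu.-integrable D (EFin \o (fun x => f x * g x)).
Proof.
move=> mD mf fM ig.
have mg : measurable_fun D g by exact/measurable_EFinP/(measurable_int mu).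
apply: (@le_integrable _ _ _ mu D mD _ (EFin \o (fun x => M * g x))).
- by apply/measurable_EFinP; exact: measurable_funM.
- move=> x Dx /=; rewrite lee_fin !normrM ler_wpM2r//.
  exact: le_trans (fM x) (ler_norm _).
- apply: (eq_integrable mD (fun x => (M%:E * (EFin \o g) x)%E)) => //.
  exact: integrableZl.
Qed.

End integrability.

Section preliminaries.
Context {R : realType}.
Local Notation m := (@lebesgue_measure R).

Lemma bigcup_itvoc_sym : \bigcup_n `](- n%:R), n%:R]%classic = [set: R].
Proof.
apply/seteqP; split => // x _; exists (Num.trunc `|x|).+1 => //=.
by have := truncnS_gt `|x|; rewrite in_itv/= ltr_norml => /andP[-> /ltW->].
Qed.

Lemma measurable_invr : measurable_fun [set: R] (@GRing.inv R).
Proof.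
rewrite -(setUv [set 0 : R]); apply/measurable_funU => //;
  first exact: measurableC.
split; first exact: measurable_fun_set1.
apply: open_continuous_measurable_fun.
  by apply: closed_openC; exact: closed_eq.
by move=> x /[!inE] /= /eqP x0; exact: inv_continuous.
Qed.

Lemma measurable_funV d (T : measurableType d) (D : set T) (f : T -> R) :
  measurable_fun D f -> measurable_fun D (fun x => (f x)^-1).
Proof. by move=> mf; apply: (measurableT_comp measurable_invr). Qed.

Lemma measurable_boole_map : measurable_fun [set: R] (@boole_map R).
Proof. by apply: measurable_funB => //; exact: measurable_invr. Qed.

Lemma measurable_iter d (T : measurableType d) (f : T -> T) n :
  measurable_fun [set: T] f -> measurable_fun [set: T] (iter n f).
Proof.
by move=> mf; elim: n => [|n ih]; [exact: measurable_id|
  exact: measurableT_comp].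
Qed.

(** The instance for the Lebesgue measure, whose measurable space and the
    canonical one on [R] are convertible but not syntactically equal. *)
Lemma lebesgue_integrable_mul (f g : R -> R) (M : R) :
  measurable_fun [set: R] f -> (forall x, `|f x| <= M) ->
  m.-integrable setT (EFin \o g) ->
  m.-integrable setT (EFin \o (fun x => f x * g x)).
Proof.
move=> mf fM ig.
exact: (@integrable_bounded_mul _ (measurableTypeR R) R m setT f g M).
Qed.

Lemma integrable_bounded_itv (F : R -> R) (M a : R) :
  measurable_fun [set: R] F -> (forall x, `|F x| <= M) ->
  m.-integrable `[(- a)%R, a] (EFin \o F).
Proof.
move=> mF FM.
have mItv : (m `[(- a)%R, a] < +oo)%E.
  by rewrite lebesgue_measure_itv/=; case: ifPn => // _; rewrite -EFinB ltry.
apply: measurable_bounded_integrable => //.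
- exact: measurable_funTS.
- by exists M; split => [|x Mx]; rewrite ?num_real// => y _;
    exact: le_trans (FM y) (ltW Mx).
Qed.

End preliminaries.

(** * Measures defined by a density *)

Section density.
Context d (T : measurableType d) (R : realType).
Variable mu : {measure set T -> \bar R}.
Variables (p : T -> R) (mp : measurable_fun [set: T] p) (p0 :
  forall x, 0 <= p x).

(** The measure with density [p] with respect to [mu].  The two hypotheses on
    [p] are arguments of the definition, without effect on its value, so that
    the measure structure can be inferred. *)
Definition density_measure (A : set T) : \bar R :=
  let _ := mp in let _ := p0 in (\int[mu]_(x in A) (p x)%:E)%E.

Let density0 : density_measure set0 = 0%E.
Proof. by rewrite /density_measure integral_set0. Qed.

Let density_ge0 A : (0 <= density_measure A)%E.
Proof. by apply: integral_ge0 => x _; rewrite lee_fin. Qed.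

Let density_sigma_additive : semi_sigma_additive density_measure.
Proof.
move=> /= F mF tF mUF; rewrite /density_measure; apply: cvg_toP.
  apply: ereal_nondecreasing_is_cvgn => m n mn.
  apply: lee_sum_nneg_natr => // k _ _; apply: integral_ge0 => /= x Fkx.
  by rewrite lee_fin.
rewrite ge0_integral_bigcup//=.
- exact/measurable_funTS/measurable_EFinP.
- by move=> x _; rewrite lee_fin.
Qed.

HB.instance Definition _ := isMeasure.Build _ _ _
  density_measure density0 density_ge0 density_sigma_additive.

Import HBNNSimple.

Lemma ge0_integral_density (f : T -> \bar R) :
  measurable_fun [set: T] f -> (forall x, 0 <= f x)%E ->
  (\int[density_measure]_x f x = \int[mu]_x (f x * (p x)%:E))%E.
Proof.
move=> mf f0.
pose f_ := nnsfun_approx measurableT mf.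
have ind (h : {nnsfun T >-> R}) :
  (\int[density_measure]_x (h x)%:E = \int[mu]_x ((h x)%:E * (p x)%:E))%E.
  under [LHS]eq_integral do rewrite fimfunE -fsumEFin//.
  rewrite [LHS]ge0_integral_fsum//; last 2 first.
  - by move=> r; exact/measurable_EFinP/measurableT_comp.
  - by move=> r x _; rewrite EFinM nnfun_muleindic_ge0.
  under [RHS]eq_integral.
    move=> x _; rewrite fimfunE -fsumEFin//.
    rewrite ge0_mule_fsuml; last by move=> r; rewrite EFinM nnfun_muleindic_ge0.
    over.
  rewrite [RHS]ge0_integral_fsum//; last 2 first.
  - move=> r; apply: emeasurable_funM; last exact/measurable_EFinP.
    exact/measurable_EFinP/measurableT_comp.
  - by move=> r x _; rewrite mule_ge0//;
      [rewrite EFinM nnfun_muleindic_ge0|rewrite lee_fin].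
  apply: eq_fsbigr => r _; rewrite integralZl_indic_nnsfun//=.
  rewrite integral_indic//= setIT.
  under [RHS]eq_integral do rewrite -EFinM -mulrA EFinM.
  rewrite /density_measure [in LHS]integral_mkcond/=.
  have [r0|r0] := ltP r 0.
    rewrite preimage_nnfun0//.
    rewrite !integral0_eq ?mule0// => x _; rewrite ?indic0 ?mul0r ?mule0//.
    by rewrite patchE/= in_set0.
  rewrite ge0_integralZl//=.
  - congr (_ * _)%E; apply: eq_integral => x _.
    by rewrite patchE indicE; case: ifPn => _; rewrite ?mul1r ?mul0r.
  - by apply/measurable_EFinP/measurable_funM.
  - by move=> x _; rewrite lee_fin mulr_ge0.
transitivity (limn (fun n => \int[density_measure]_x (f_ n x)%:E)%E).
  rewrite -monotone_convergence//=.
  - by apply: eq_integral => x _; apply/esym/cvg_lim => //=;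
      exact: cvg_nnsfun_approx.
  - by move=> n; exact/measurable_EFinP.
  - by move=> n x _; rewrite lee_fin.
  - by move=> x _ m n mn; rewrite lee_fin; exact/lefP/nd_nnsfun_approx.
transitivity (limn (fun n => \int[mu]_x ((f_ n x)%:E * (p x)%:E))%E).
  by apply: congr_lim; apply/funext => n; exact: ind.
rewrite -monotone_convergence//=.
- apply: eq_integral => x _; apply/cvg_lim => //=; apply: cvgeZr => //.
  exact: cvg_nnsfun_approx.
- by move=> n; apply: emeasurable_funM; exact/measurable_EFinP.
- by move=> n x _; rewrite mule_ge0// lee_fin.
- move=> x _ m n mn; rewrite lee_pmul// ?lee_fin//.
  exact/lefP/nd_nnsfun_approx.
Qed.

End density.

(** * Cauchy densities *)

Section cauchy.
Context {R : realType}.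
Local Notation m := (@lebesgue_measure R).
Implicit Types (u v x a b : R).

(** The Cauchy density with location [u] and scale [v], which is also the
    Poisson kernel of the upper half-plane at the point [u + i v]. *)
Definition cauchy_pdf u v x : R := v / (pi * ((x - u) ^+ 2 + v ^+ 2)).

(** For [v > 0], the primitive of [cauchy_pdf u v] that vanishes at [u]; the
    distribution function of the Cauchy law is [cauchy_cdf u v + 1/2]. *)
Definition cauchy_cdf u v x : R := atan ((x - u) / v) / pi.

Lemma cauchy_pdf_ge0 u v x : 0 <= v -> 0 <= cauchy_pdf u v x.
Proof.
by move=> v0; rewrite /cauchy_pdf divr_ge0// mulr_ge0 ?pi_ge0// addr_ge0//
  sqr_ge0.
Qed.

Lemma cauchy_pdf_gt0 u v x : 0 < v -> 0 < cauchy_pdf u v x.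
Proof.
move=> v0; rewrite /cauchy_pdf divr_gt0// mulr_gt0 ?pi_gt0//.
by rewrite ltr_wpDl ?sqr_ge0// exprn_gt0.
Qed.

Lemma cauchy_pdfC u v x : cauchy_pdf u v x = cauchy_pdf x v u.
Proof. by rewrite /cauchy_pdf -sqrrN opprB. Qed.

Lemma measurable_cauchy_pdf d (T : measurableType d) (f g : T -> R) v :
  measurable_fun [set: T] f -> measurable_fun [set: T] g ->
  measurable_fun [set: T] (fun t => cauchy_pdf (f t) v (g t)).
Proof.
move=> mf mg; apply: measurable_funM => //; apply: measurable_funV.
apply: measurable_funM => //; apply: measurable_funD => //.
by apply: measurable_funX; exact: measurable_funB.
Qed.

Lemma is_derive_cauchy_cdf u v x : 0 < v ->
  is_derive x 1 (cauchy_cdf u v) (cauchy_pdf u v x).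
Proof.
move=> v0.
have pi0 : (pi : R) != 0 by rewrite gt_eqF// pi_gt0.
have d1 : is_derive x 1 (fun y : R => (y - u) / v) v^-1.
  by apply: is_derive_eq; rewrite scaler0 add0r subr0 /GRing.scale/= mulr1.
have d2 : is_derive ((x - u) / v) 1 (@atan R) (1 + ((x - u) / v) ^+ 2)^-1.
  exact: is_derive1_atan.
have d3 : is_derive x 1 (atan \o (fun y : R =>
  (y - u) / v)) ((1 + ((x - u) / v) ^+ 2)^-1 * v^-1) by exact: is_derive1_comp.
have -> : cauchy_cdf u v = (pi^-1 *: (atan \o (fun y : R => (y - u) / v))).
  by apply/funext => y; rewrite /cauchy_cdf /= mulrC.
apply: is_derive_eq; rewrite /GRing.scale/= /cauchy_pdf.
have q0 : (x - u) ^+ 2 + v ^+ 2 != 0.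
  by rewrite gt_eqF// ltr_wpDl ?sqr_ge0// exprn_gt0.
have v0' : v != 0 by rewrite gt_eqF.
have -> : 1 + ((x - u) / v) ^+ 2 = ((x - u) ^+ 2 + v ^+ 2) / v ^+ 2.
  by field.
(* [field] needs [pi] to be a variable, or it unfolds its definition *)
move: pi0; generalize (pi : R) => c c0.
by field; rewrite q0 c0.
Qed.

Lemma continuous_cauchy_pdf u v : 0 < v -> continuous (cauchy_pdf u v).
Proof.
move=> v0 x.
apply: cvgM; first exact: cvg_cst.
apply: cvgV; first by rewrite mulf_neq0// gt_eqF ?pi_gt0// ltr_wpDl ?sqr_ge0//
  exprn_gt0.
apply: cvgM; first exact: cvg_cst.
apply: cvgD; last exact: cvg_cst.
apply: (@continuous_comp _ _ _ (fun y : R => y - u) (fun y : R => y ^+ 2)).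
  by apply: cvgB; [exact: cvg_id|exact: cvg_cst].
exact: exprn_continuous.
Qed.

Lemma continuous_cauchy_cdf u v : 0 < v -> continuous (cauchy_cdf u v).
Proof.
move=> v0 x; apply/differentiable_continuous/derivable1_diffP.
by have [] := is_derive_cauchy_cdf u x v0.
Qed.

Lemma le_cauchy_cdf u v : 0 < v -> {homo cauchy_cdf u v : x y / x <= y}.
Proof.
move=> v0 x y xy; rewrite /cauchy_cdf ler_pM2r ?invr_gt0 ?pi_gt0//.
by apply: le_atan; rewrite ler_pM2r ?invr_gt0// lerB.
Qed.

Lemma integral_cauchy_pdf_itvoc u v a b : 0 < v -> a <= b ->
  (\int[m]_(x in `]a, b]) (cauchy_pdf u v x)%:E =
   (cauchy_cdf u v b - cauchy_cdf u v a)%:E)%E.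
Proof.
move=> v0; rewrite le_eqVlt => /predU1P[->|ab].
  by rewrite set_itvoc0 integral_set0 subrr.
rewrite integral_itv_obnd_cbnd; last first.
  by apply/measurable_EFinP/measurable_funTS; exact: measurable_cauchy_pdf.
rewrite (@continuous_FTC2 _ _ (cauchy_cdf u v))//.
- by apply: continuous_subspaceT; exact: continuous_cauchy_pdf.
- split.
  + by move=> x _; have [] := is_derive_cauchy_cdf u x v0.
  + by apply: cvg_at_right_filter; exact: continuous_cauchy_cdf.
  + by apply: cvg_at_left_filter; exact: continuous_cauchy_cdf.
- move=> x _; rewrite derive1E.
  by have [_ ->] := is_derive_cauchy_cdf u x v0.
Qed.

Lemma cvg_cauchy_cdfy u v : 0 < v -> cauchy_cdf u v x @[x --> +oo] --> (2^-1 :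
  R).
Proof.
move=> v0.
have -> : 2^-1 = pi / 2 / pi :> R.
  by rewrite mulrAC divff ?mul1r// gt_eqF// pi_gt0.
apply: cvgM; last exact: cvg_cst.
apply: (cvg_comp (fun x : R => (x - u) / v) (@atan R)); last exact: cvgy_atan.
by apply: gt0_cvgMly; [rewrite invr_gt0|exact: cvg_addrr].
Qed.

Lemma cauchy_cdfN u v x : cauchy_cdf u v (- x) = - cauchy_cdf (- u) v x.
Proof. by rewrite /cauchy_cdf -opprD mulNr atanN mulNr opprK. Qed.

Lemma integral_cauchy_pdf u v : 0 < v ->
  (\int[m]_x (cauchy_pdf u v x)%:E = 1)%E.
Proof.
move=> v0.
have mp : measurable_fun [set: R] (EFin \o cauchy_pdf u v).
  by apply/measurable_EFinP; exact: measurable_cauchy_pdf.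
rewrite -bigcup_itvoc_sym; apply: (cvg_unique _
  (ge0_nondecreasing_set_cvg_integral _ _ _ _)) => //=.
- move=> i j ij; apply/subsetPset/subset_itv;
    rewrite leBSide//= ?lerN2 ler_nat//.
- by move=> i; exact: measurable_funTS.
- by move=> i x _; rewrite lee_fin cauchy_pdf_ge0// ltW.
under eq_fun.
  move=> n; rewrite integral_cauchy_pdf_itvoc//; last by rewrite ge0_cp.
  rewrite cauchy_cdfN opprK.
  over.
apply: cvg_EFin; first by near=> n.
rewrite [X in _ --> X](splitr 1) div1r.
apply: cvgD.
  apply: (cvg_comp (fun n : nat => n%:R : R) (cauchy_cdf u v)).
    exact: cvgr_idn.
  exact: cvg_cauchy_cdfy.
apply: (cvg_comp (fun n : nat => n%:R : R) (cauchy_cdf (- u) v)).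
  exact: cvgr_idn.
exact: cvg_cauchy_cdfy.
Unshelve. all: by end_near. Qed.

End cauchy.

(** * The Boole map and its extension to the upper half-plane *)

Section boole.
Context {R : realType}.
Implicit Types (u v x a : R).

(** The map [w |-> w - 1/w], where the complex number [u + i v] is encoded as
    the pair [(u, v)]. *)
Definition boole_hp (w : R * R) : R * R :=
  let r := w.1 ^+ 2 + w.2 ^+ 2 in (w.1 - w.1 / r, w.2 + w.2 / r).

(** The two preimages of a point have product [-1]. *)
Lemma boole_mapNV x : boole_map (- x^-1) = boole_map x.
Proof. by rewrite /boole_map invrN invrK opprK addrC. Qed.

Lemma le_boole_map x y : 0 < x -> 0 < y ->
  (boole_map x <= boole_map y) = (x <= y).
Proof.
move=> x0 y0; rewrite -subr_ge0 -[RHS]subr_ge0.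
have -> : boole_map y - boole_map x = (y - x) * (1 + (x * y)^-1).
  by rewrite /boole_map; field; rewrite !gt_eqF.
by rewrite pmulr_lge0// ltr_wpDr// invr_ge0 mulr_ge0 ?ltW.
Qed.

Lemma lt_boole_map x y : 0 < x -> 0 < y ->
  (boole_map x < boole_map y) = (x < y).
Proof. by move=> x0 y0; rewrite !ltNge le_boole_map. Qed.

(** The positive root of [p ^+ 2 - a * p - 1 = 0]. *)
Lemma boole_map_onto a : exists2 p : R, 0 < p & boole_map p = a.
Proof.
have s0 : 0 < a ^+ 2 + 4 by rewrite ltr_wpDl ?sqr_ge0.
set s := Num.sqrt (a ^+ 2 + 4).
have s2 : s ^+ 2 = a ^+ 2 + 4 by rewrite sqr_sqrtr// ltW.
have as0 : 0 < a + s.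
  rewrite -(opprK a) addrC subr_gt0.
  apply: (le_lt_trans (ler_norm _)); rewrite normrN -sqrtr_sqr.
  by rewrite ltr_sqrt// ltrDl.
exists ((a + s) / 2); first by rewrite divr_gt0.
apply/eqP; rewrite -subr_eq0 /boole_map.
have -> : (a + s) / 2 - ((a + s) / 2)^-1 - a
    = (s ^+ 2 - (a ^+ 2 + 4)) / (2 * (a + s)).
  by field; rewrite gt_eqF.
by rewrite s2 subrr mul0r.
Qed.

(** With [T'(x) = 1 + 1/x^2], the left-hand side divided by [T'(x)] is the sum,
    over the two preimages [y = x] and [y = - 1/x] of [T x], of
    [cauchy_pdf u v y / T'(y)]: the transfer operator of [T] maps the Cauchy
    density at [w] to the Cauchy density at [boole_hp w]. *)
Lemma cauchy_pdf_boole u v x : 0 < v -> 0 < x ->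
  cauchy_pdf u v x + cauchy_pdf u v (- x^-1) / x ^+ 2 =
  cauchy_pdf (boole_hp (u, v)).1 (boole_hp (u, v)).2 (boole_map x)
    * (1 + (x ^+ 2)^-1).
Proof.
move=> v0 x0; rewrite /cauchy_pdf /boole_hp /boole_map/=.
have : (pi : R) != 0 by rewrite gt_eqF// pi_gt0.
generalize (pi : R) => c c0.
have r0 : u ^+ 2 + v ^+ 2 != 0 by rewrite gt_eqF// ltr_wpDl ?sqr_ge0//
  exprn_gt0.
have p0 : (x - u) ^+ 2 + v ^+ 2 != 0.
  by rewrite gt_eqF// ltr_wpDl ?sqr_ge0// exprn_gt0.
have xn0 : x != 0 by rewrite gt_eqF.
have q0 : (1 + u * x) ^+ 2 + (v * x) ^+ 2 != 0.
  by rewrite gt_eqF// ltr_wpDl ?sqr_ge0// exprn_gt0// mulr_gt0.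
(* the square of [|T x - T w| = |x - w| |1 + 1 / (x w)|] *)
have -> : (x - x^-1 - (u - u / (u ^+ 2 + v ^+ 2))) ^+ 2 +
    (v + v / (u ^+ 2 + v ^+ 2)) ^+ 2 =
    ((x - u) ^+ 2 + v ^+ 2) * ((1 + u * x) ^+ 2 + (v * x) ^+ 2)
     / (x ^+ 2 * (u ^+ 2 + v ^+ 2)).
  by field; rewrite r0 xn0.
have -> : (- x^-1 - u) ^+ 2 + v ^+ 2 =
    ((1 + u * x) ^+ 2 + (v * x) ^+ 2) / x ^+ 2 by field.
by field; rewrite r0 xn0 p0 q0 c0.
Qed.

End boole.

Section boole_push.
Context {R : realType}.
Local Notation m := (@lebesgue_measure R).
Implicit Types (u v x a b : R).

Lemma boole_hp_gt0 (w : R * R) : 0 < w.2 -> 0 < (boole_hp w).2.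
Proof.
by move=> w0; rewrite /boole_hp/= ltr_wpDr// divr_ge0 ?addr_ge0 ?sqr_ge0// ltW.
Qed.

(** The integrated form of [cauchy_pdf_boole], over the interval [[p, q]]. *)
Lemma cauchy_cdf_boole u v p q : 0 < v -> 0 < p -> p <= q ->
  let w := boole_hp (u, v) in
  (cauchy_cdf u v q - cauchy_cdf u v p) +
  (cauchy_cdf u v (- q^-1) - cauchy_cdf u v (- p^-1)) =
  cauchy_cdf w.1 w.2 (boole_map q) - cauchy_cdf w.1 w.2 (boole_map p).
Proof.
move=> v0 p0; rewrite le_eqVlt => /predU1P[->|pq] w;
  first by rewrite !subrr addr0.
have w0 : 0 < w.2 by exact: boole_hp_gt0.
pose psi x : R := cauchy_cdf u v x + cauchy_cdf u v (- x^-1)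
                 - cauchy_cdf w.1 w.2 (boole_map x).
have dpsi x : 0 < x -> is_derive x 1 psi 0.
  move=> x0.
  have xn0 : x != 0 by rewrite gt_eqF.
  have d1 : is_derive x 1 (fun y : R => y^-1) (- (x ^+ 2)^-1).
    have := @is_deriveV R id x 1 1 xn0 (is_derive_id _ _).
    by rewrite /GRing.scale/= mulr1.
  have d2 : is_derive x 1 (fun y : R => - y^-1) (x ^+ 2)^-1.
    by apply: is_derive_eq; rewrite opprK.
  have d3 : is_derive x 1 (@boole_map R) (1 + (x ^+ 2)^-1).
    by apply: is_derive_eq; rewrite opprK.
  have e1 := is_derive_cauchy_cdf u x v0.
  have e2 : is_derive x 1 (cauchy_cdf u v \o (fun y : R => - y^-1))
      (cauchy_pdf u v (- x^-1) * (x ^+ 2)^-1).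
    apply: is_derive1_comp; exact: is_derive_cauchy_cdf.
  have e3 : is_derive x 1 (cauchy_cdf w.1 w.2 \o (@boole_map R))
      (cauchy_pdf w.1 w.2 (boole_map x) * (1 + (x ^+ 2)^-1)).
    apply: is_derive1_comp; exact: is_derive_cauchy_cdf.
  have -> : psi = (cauchy_cdf u v \+ (cauchy_cdf u v \o (fun y : R => - y^-1)))
     \- (cauchy_cdf w.1 w.2 \o (@boole_map R)) by [].
  apply: is_derive_eq; apply/eqP; rewrite subr_eq0; apply/eqP.
  exact: cauchy_pdf_boole.
have psid x : x \in `]p, q[ -> is_derive x 1 psi (cst 0 x).
  by rewrite in_itv/= => /andP[px _]; apply: dpsi; exact: lt_trans px.
have psic : {within `[p, q], continuous psi}.
  apply: derivable_within_continuous => x; rewrite in_itv/= => /andP[px _].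
  by have [] := dpsi x (lt_le_trans p0 px).
have [c _] := MVT pq psid psic.
rewrite mul0r => /eqP; rewrite /psi => h; apply/eqP; rewrite -subr_eq0 -(eqP h).
apply/eqP; ring.
Qed.

(** The origin has to be removed: the totalized map sends [0] to [0], so that
    the preimage contains [0] as soon as the interval does. *)
Lemma preimage_boole_itvoc p q : 0 < p -> 0 < q ->
  (@boole_map R) @^-1` `]boole_map p, boole_map q] `\ 0 =
  `]p, q] `|` `](- p^-1), (- q^-1)].
Proof.
move=> p0 q0; apply/seteqP; split => x /=; rewrite !in_itv/=.
- move=> [/andP[px xq]] /eqP; rewrite neq_lt => /orP[x0|x0]; last first.
    by left; rewrite -lt_boole_map// px -le_boole_map.
  right.
  have y0 : 0 < - x^-1 by rewrite oppr_gt0 invr_lt0.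
  move: px xq; rewrite -(boole_mapNV x) lt_boole_map// le_boole_map// => px xq.
  apply/andP; split.
  - by rewrite ltrNl -[ltLHS]invrK invrN ltf_pV2 ?posrE// invr_gt0.
  - by rewrite lerNr -[leRHS]invrK invrN lef_pV2 ?posrE// invr_gt0.
- move=> [/andP[px xq]|/andP[px xq]].
    have x0 : 0 < x by exact: lt_trans px.
    by rewrite lt_boole_map// le_boole_map// px xq; split=> //; apply/eqP;
      rewrite gt_eqF.
  have x0 : x < 0 by rewrite (le_lt_trans xq)// oppr_lt0 invr_gt0.
  split; last by apply/eqP; rewrite lt_eqF.
  have y0 : 0 < - x^-1 by rewrite oppr_gt0 invr_lt0.
  rewrite -(boole_mapNV x) lt_boole_map// le_boole_map//; apply/andP; split.
  - by rewrite -invrN -[ltLHS]invrK ltf_pV2 ?posrE ?invr_gt0 ?oppr_gt0// ltrNl.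
  - by rewrite -invrN -[leRHS]invrK lef_pV2 ?posrE ?invr_gt0 ?oppr_gt0// lerNr.
Qed.

(** The image of a Cauchy law under the Boole map is a Cauchy law. *)
Lemma ge0_integral_boole_cauchy u v (f : R -> \bar R) : 0 < v ->
  measurable_fun [set: R] f -> (forall x, 0 <= f x)%E ->
  (\int[m]_x (f (boole_map x) * (cauchy_pdf u v x)%:E) =
   \int[m]_x (f x * (cauchy_pdf (boole_hp (u, v)).1 (boole_hp (u, v)).2
     x)%:E))%E.
Proof.
move=> v0 mf f0.
pose w := boole_hp (u, v).
have w0 : 0 < w.2 by exact: boole_hp_gt0.
have mp1 : measurable_fun [set: R] (cauchy_pdf u v)
  by exact: measurable_cauchy_pdf.
have mp2 : measurable_fun [set: R] (cauchy_pdf w.1 w.2)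
  by exact: measurable_cauchy_pdf.
have p1 x : 0 <= cauchy_pdf u v x by exact/cauchy_pdf_ge0/ltW.
have p2 x : 0 <= cauchy_pdf w.1 w.2 x by exact/cauchy_pdf_ge0/ltW.
have mT : @measurable_fun _ _ (measurableTypeR R) (measurableTypeR R) setT
  (@boole_map R).
  exact: measurable_boole_map.
have mfT : measurable_fun [set: R] (f \o (@boole_map R))
  by exact: (measurableT_comp mf mT).
have fT0 x : (0 <= (f \o (@boole_map R)) x)%E by exact: f0.
rewrite -(ge0_integral_density m mp1 p1 mfT fT0) -(ge0_integral_density m mp2
  p2 mf f0).
have fT0' : {in [set: measurableTypeR R], forall y, (0 <= f y)%E} by move=> y _.
rewrite -[LHS](ge0_integral_pushforward mT (density_measure m mp1 p1)
  measurableT mf fT0').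
(* it suffices to compare the two measures on intervals *)
apply: eq_measure_integral => A mA _.
apply: (@measure_unique _ R (measurableTypeR R) (@ocitv R) (fun n =>
  `](- n%:R), n%:R]%classic) erefl _ _
  bigcup_itvoc_sym _ _ _ _ A mA).
- exact: ocitvI.
- by move=> i; exact: is_ocitv.
- move=> B [[a b] _ <-]/=.
  rewrite /pushforward /density_measure.
  have [ba|ab] := leP b a.
    by rewrite set_itv_ge ?bnd_simp -?leNgt// preimage_set0 !integral_set0.
  have [p p0 pa] := boole_map_onto a.
  have [q q0 qb] := boole_map_onto b.
  rewrite -pa -qb in ab *.
  have pq : p < q by rewrite -lt_boole_map.
  have mN : measurable ([set 0] : set (measurableTypeR R))
    by exact: measurable_set1.
  have mD : measurable ((@boole_map R) @^-1` `]boole_map p, boole_map q] :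
    set (measurableTypeR R)).
    by rewrite -[_ @^-1` _]setTI; exact: mT.
  rewrite (ge0_negligible_integral mN mD _ _ (lebesgue_measure_set1 _))//;
    last 2 first.
  + by apply: measurable_funTS; exact/measurable_EFinP.
  + by move=> x _; rewrite lee_fin.
  rewrite preimage_boole_itvoc// ge0_integral_setU//=; last 3 first.
  + exact/measurable_funTS/measurable_EFinP.
  + by move=> x _; rewrite lee_fin.
  + apply/disj_set2P/seteqP; split => // x [] /=; rewrite !in_itv/=.
    move=> /andP[px _] /andP[_ xq]; have := lt_le_trans px xq.
    by rewrite ltNge (le_trans _ (ltW p0))// oppr_le0 invr_ge0 ltW.
  rewrite !integral_cauchy_pdf_itvoc//; [|
    exact: ltW|by rewrite lerN2 lef_pV2 ?posrE ?ltW..|exact: ltW].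
  by rewrite -EFinD cauchy_cdf_boole// ltW.
- move=> k; rewrite /pushforward /density_measure.
  apply: (@le_lt_trans _ _ (\int[m]_x (cauchy_pdf u v x)%:E)%E).
    apply: ge0_subset_integral => //.
    + by rewrite -[_ @^-1` _]setTI; exact: mT.
    + exact/measurable_EFinP.
    + by move=> x _; rewrite lee_fin.
  by rewrite integral_cauchy_pdf// ltry.
Qed.

Lemma ge0_integral_iter_boole_cauchy n u v (f : R -> \bar R) : 0 < v ->
  measurable_fun [set: R] f -> (forall x, 0 <= f x)%E ->
  let w := iter n (@boole_hp R) (u, v) in
  (\int[m]_x (f (iter n (@boole_map R) x) * (cauchy_pdf u v x)%:E) =
   \int[m]_x (f x * (cauchy_pdf w.1 w.2 x)%:E))%E.
Proof.
move=> v0 mf f0; elim: n u v v0 => [//|n ih] u v v0 w.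
have E : w = iter n (@boole_hp R) ((boole_hp (u, v)).1, (boole_hp (u, v)).2).
  by rewrite /w iterSr.
under eq_integral do rewrite iterSr.
have mfn : measurable_fun [set: R] (f \o iter n (@boole_map R)).
  by apply: (measurableT_comp mf);
    exact: (measurable_iter n (@measurable_boole_map R)).
have fn0 x : (0 <= (f \o iter n (@boole_map R)) x)%E by exact: f0.
rewrite (ge0_integral_boole_cauchy u v0 mfn fn0) E -ih//.
exact: (@boole_hp_gt0 (u, v)).
Qed.

End boole_push.

(** * Orbits in the upper half-plane *)

Section orbit.
Context {R : realType}.
Implicit Types (w : R * R).

Lemma boole_hp_ge w : 0 < w.2 -> w.2 <= (boole_hp w).2.
Proof.
by move=> w0; rewrite /boole_hp/= lerDl divr_ge0 ?addr_ge0 ?sqr_ge0// ltW.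
Qed.

(** If [|w| >= 1] the absolute value of the real part does not increase;
    otherwise the new one is at most [|u| / |w|^2 <= 1/v]. *)
Lemma boole_hp_re_le w U : 0 < w.2 -> `|w.1| <= U -> w.2^-1 <= U ->
  `|(boole_hp w).1| <= U.
Proof.
case: w => u v /= v0 uU vU.
have v20 : 0 < v ^+ 2 by rewrite exprn_gt0.
have u20 : 0 <= u ^+ 2 by exact: sqr_ge0.
set r := u ^+ 2 + v ^+ 2; have r0 : 0 < r by rewrite /r ltr_wpDl.
have -> : u - u / r = u * (1 - r^-1) by rewrite mulrBr mulr1.
rewrite normrM.
have [r1|r1] := lerP 1 r.
  apply: le_trans uU; rewrite -[leRHS]mulr1 ler_wpM2l// ger0_norm.
    by rewrite gerBl invr_ge0 ltW.
  by rewrite subr_ge0 invf_le1.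
have ur : `|u| * r^-1 <= v^-1.
  rewrite ler_pdivrMr// mulrC ler_pdivlMr//.
  have := sqr_ge0 (`|u| - v); rewrite sqrrB -normrX (ger0_norm u20) -/r => h.
  rewrite /r; have : 0 <= `|u| * v by rewrite mulr_ge0// ltW.
  by move: h; rewrite mulr2n; lra.
apply: le_trans vU; apply: le_trans ur; rewrite ler_wpM2l//.
rewrite ler0_norm ?subr_le0 ?invf_ge1 ?(ltW r1)// opprB gerBl//.
Qed.

Variable w : R * R.
Hypothesis w0 : 0 < w.2.
Let z n := iter n (@boole_hp R) w.

Lemma iter_boole_hp_ge n : w.2 <= (z n).2.
Proof.
elim: n => [//|n ih]; apply: (le_trans ih); rewrite /z iterS.
by apply: boole_hp_ge; exact: lt_le_trans ih.
Qed.

Lemma iter_boole_hp_gt0 n : 0 < (z n).2.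
Proof. exact: lt_le_trans (iter_boole_hp_ge n). Qed.

Lemma iter_boole_hp_re_le n : `|(z n).1| <= Num.max `|w.1| w.2^-1.
Proof.
elim: n => [|n ih]; first by rewrite /z/= le_max lexx.
rewrite /z iterS; apply: boole_hp_re_le ih _; first exact: iter_boole_hp_gt0.
rewrite le_max; apply/orP; right.
by rewrite lef_pV2 ?posrE ?iter_boole_hp_gt0// iter_boole_hp_ge.
Qed.

Lemma iter_boole_hp_cvgy : (z n).2 @[n --> \oo] --> +oo.
Proof.
set U := Num.max `|w.1| w.2^-1.
have U0 : 0 < U by rewrite lt_max invr_gt0 w0 orbT.
have nd : {homo (fun n => (z n).2) : n m / (n <= m)%N >-> n <= m}.
  apply/nondecreasing_seqP => n; rewrite /z iterS; apply: boole_hp_ge.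
  exact: iter_boole_hp_gt0.
have ub V : 0 < V -> exists n, V < (z n).2.
  move=> V0; apply: contrapT => /forallNP h.
  have {}h n : (z n).2 <= V by rewrite leNgt; apply/negP; exact: h.
  (* a lower bound for the increments, if the imaginary parts were bounded *)
  set d := w.2 / (U ^+ 2 + V ^+ 2).
  have UV : 0 < U ^+ 2 + V ^+ 2 by rewrite addr_gt0// exprn_gt0.
  have d0 : 0 < d by rewrite divr_gt0.
  have lb n : n%:R * d <= (z n).2.
    elim: n => [|n ih]; first by rewrite mul0r ltW// iter_boole_hp_gt0.
    have -> : (z n.+1).2 = (z n).2 + (z n).2 / ((z n).1 ^+ 2 + (z n).2 ^+ 2)
      by [].
    rewrite -natr1 mulrDl mul1r lerD//.
    rewrite ler_pM ?invr_ge0 ?(ltW w0) ?(ltW UV)//;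
      first exact: iter_boole_hp_ge.
    have zn0 := iter_boole_hp_gt0 n.
    rewrite lef_pV2 ?posrE//.
      apply: lerD; last first.
        by rewrite lerXn2r ?nnegrE ?(ltW zn0) ?(ltW V0).
      rewrite -[leLHS]real_normK ?num_real// lerXn2r ?nnegrE ?(ltW U0)//.
      exact: iter_boole_hp_re_le.
    by rewrite ltr_wpDl ?sqr_ge0// exprn_gt0.
  have := lb (Num.trunc (V / d)).+1; rewrite leNgt => /negP; apply.
  apply: le_lt_trans (h _) _; rewrite -ltr_pdivrMr//; exact: truncnS_gt.
apply/cvgryPge => A; have [N hN] := ub (Num.max A 1) ltac:(by rewrite lt_max
  ltr01 orbT).
exists N => // n /= Nn; apply: le_trans (nd _ _ Nn); apply: le_trans (ltW hN).
by rewrite le_max lexx.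
Qed.

End orbit.

(** * Averages against wide Cauchy densities *)

Section layer_cake.
Context {R : realType}.
Local Notation m := (@lebesgue_measure R).
Implicit Types (v x a : R).

(** The opposite of the derivative at [a] of the centred Cauchy density of scale
    [v]: the weight, for [a >= 0], of the indicator of [[-a, a]] in the layer
    cake decomposition of this density. *)
Definition cauchy_slope v a : R := 2 * a * v / (pi * (a ^+ 2 + v ^+ 2) ^+ 2).

Lemma cauchy_slope_ge0 v a : 0 <= v -> 0 <= a -> 0 <= cauchy_slope v a.
Proof.
move=> v0 a0; rewrite /cauchy_slope; apply: divr_ge0;
  first by rewrite mulr_ge0// mulr_ge0.
by apply: mulr_ge0; [exact: pi_ge0|exact: sqr_ge0].
Qed.

Lemma cauchy_slope_le v a : 0 < v -> 0 <= a ->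
  cauchy_slope v a <= 2 * a / (pi * v ^+ 3).
Proof.
move=> v0 a0; rewrite /cauchy_slope.
have v2 : 0 < v ^+ 2 by rewrite exprn_gt0.
have p0 : 0 < (pi : R) by rewrite pi_gt0.
have av : 0 < a ^+ 2 + v ^+ 2 by rewrite ltr_wpDl ?sqr_ge0.
rewrite ler_pdivlMr; last by rewrite mulr_gt0// exprn_gt0.
rewrite mulrAC ler_pdivrMr; last by rewrite mulr_gt0 ?exprn_gt0.
have -> : 2 * a * v * (pi * v ^+ 3) = 2 * a * (pi * (v ^+ 2) ^+ 2).
  by generalize (pi : R) => c; ring.
rewrite ler_wpM2l ?mulr_ge0// ler_wpM2l ?(ltW p0)//.
by rewrite lerXn2r ?nnegrE ?(ltW v2) ?(ltW av)// lerDr sqr_ge0.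
Qed.

Lemma measurable_cauchy_slope d (T : measurableType d) (f : T -> R) v :
  measurable_fun [set: T] f -> measurable_fun [set: T] (fun t =>
    cauchy_slope v (f t)).
Proof.
move=> mf; apply: measurable_funM.
  by apply: measurable_funM => //; apply: measurable_funM.
apply: measurable_funV; apply: measurable_funM => //.
by apply: measurable_funX; apply: measurable_funD => //; exact: measurable_funX.
Qed.

Lemma is_derive_cauchy_pdf v x : 0 < v ->
  is_derive x 1 (- cauchy_pdf 0 v) (cauchy_slope v x).
Proof.
move=> v0.
have : (pi : R) != 0 by rewrite gt_eqF// pi_gt0.
rewrite /cauchy_slope.
have -> : - cauchy_pdf 0 v = fun y => (- v / pi) * (y ^+ 2 + v ^+ 2)^-1.
  apply/funext => y; rewrite -[LHS]/(- cauchy_pdf 0 v y) /cauchy_pdf subr0.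
  by rewrite invfM mulrA mulNr mulNr.
move: (pi : R) => c c0.
have q0 : x ^+ 2 + v ^+ 2 != 0 by rewrite gt_eqF// ltr_wpDl ?sqr_ge0//
  exprn_gt0.
have d1 : is_derive x 1 (fun y : R => y ^+ 2 + v ^+ 2) (2 * x).
  by apply: is_derive_eq; rewrite addr0 /GRing.scale/= mulr1 mulr_natl.
have d2 := @is_deriveV R (fun y : R => y ^+ 2 + v ^+ 2) x _ 1 q0 d1.
apply: is_derive_eq; rewrite /GRing.scale/=.
by field; rewrite q0 c0.
Qed.

Lemma cvg_cauchy_pdfy v : 0 < v -> cauchy_pdf 0 v x @[x --> +oo] --> (0 : R).
Proof.
move=> v0; rewrite -[X in _ --> X](mulr0 (v / pi)).
under eq_cvg do rewrite /cauchy_pdf subr0 invfM mulrA.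
apply: cvgM; first exact: cvg_cst.
apply/gtr0_cvgV0.
  by apply: nearW => x; rewrite ltr_wpDl ?sqr_ge0// exprn_gt0.
apply: (cvg_comp (fun x : R => x ^+ 2) (fun x : R => x + v ^+ 2)).
  exact: cvgr_expr2.
exact: cvg_addrr.
Qed.

Lemma cauchy_pdf_norm v x : cauchy_pdf 0 v `|x| = cauchy_pdf 0 v x.
Proof. by rewrite /cauchy_pdf !subr0 real_normK// num_real. Qed.

Lemma continuous_cauchy_slope v : 0 < v -> continuous (cauchy_slope v).
Proof.
move=> v0 x; rewrite /cauchy_slope.
have p0 : (pi : R) != 0 by rewrite gt_eqF// pi_gt0.
have q0 : x ^+ 2 + v ^+ 2 != 0 by rewrite gt_eqF// ltr_wpDl ?sqr_ge0//
  exprn_gt0.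
apply: cvgM.
  by apply: cvgM; [apply: cvgM; [exact: cvg_cst|exact: cvg_id]|exact: cvg_cst].
apply: cvgV; first by rewrite mulf_neq0// expf_neq0.
apply: cvgM; first exact: cvg_cst.
apply: (@continuous_comp _ _ _ (fun y : R => y ^+ 2 + v ^+ 2) (fun y : R =>
  y ^+ 2)).
  by apply: cvgD; [exact: exprn_continuous|exact: cvg_cst].
exact: exprn_continuous.
Qed.

Lemma integral_cauchy_slope v x : 0 < v ->
  (\int[m]_(a in `[`|x|%R, +oo[) (cauchy_slope v a)%:E = (cauchy_pdf 0 v
    x)%:E)%E.
Proof.
move=> v0.
have dF y := is_derive_cauchy_pdf y v0.
rewrite (@ge0_continuous_FTC2y _ _ (- cauchy_pdf 0 v) _ 0).
- by rewrite add0e -EFinN -[in LHS]/(- - cauchy_pdf 0 v `|x|) opprK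
    cauchy_pdf_norm.
- by move=> a xa; apply: cauchy_slope_ge0; [exact: ltW|exact: le_trans xa].
- by apply: continuous_subspaceT; exact: continuous_cauchy_slope.
- by rewrite -[X in _ --> X]oppr0; apply: cvgN; exact: cvg_cauchy_pdfy.
- by move=> y _; have [] := dF y.
- apply: cvg_at_right_filter; apply: differentiable_continuous.
  by apply/derivable1_diffP; have [] := dF `|x|.
- by move=> y _; rewrite derive1E; have [_ ->] := dF y.
Qed.

Lemma ge0_integral_cauchy_layer v (F : R -> R) : 0 < v ->
  measurable_fun [set: R] F -> (forall x, 0 <= F x) ->
  (\int[m]_x (F x * cauchy_pdf 0 v x)%:E =
   \int[m]_(a in `[0%R, +oo[)
     ((cauchy_slope v a)%:E * \int[m]_(x in `[(- a)%R, a]) (F x)%:E))%E.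
Proof.
move=> v0 mF F0.
pose f (z : measurableTypeR R * measurableTypeR R) : \bar R :=
  if `|z.1| <= z.2 then (F z.1 * cauchy_slope v z.2)%:E else 0%E.
have f0 z : (0 <= f z)%E.
  rewrite /f; case: ifPn => // h; rewrite lee_fin mulr_ge0//.
  by apply: cauchy_slope_ge0; [exact: ltW|exact: le_trans h].
have mf : measurable_fun [set: measurableTypeR R * measurableTypeR R] f.
  apply: measurable_fun_if => //.
  - apply: measurable_fun_ler; last exact: measurable_snd.
    by apply: measurableT_comp => //; exact: measurable_fst.
  - apply: measurable_funTS; apply/measurable_EFinP; apply: measurable_funM.
      exact: (measurableT_comp mF).
    exact: measurable_cauchy_slope.
transitivity (\int[m]_x \int[m]_a f (x, a))%E.
  apply: eq_integral => x _.
  rewrite EFinM -integral_cauchy_slope// -ge0_integralZl//; last 3 first.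
  - by apply: measurable_funTS; apply/measurable_EFinP;
      exact: measurable_cauchy_slope.
  - move=> a /=; rewrite in_itv/= andbT => xa; rewrite lee_fin.
    by apply: cauchy_slope_ge0; [exact: ltW|exact: le_trans xa].
  - by rewrite lee_fin.
  rewrite integral_mkcond; apply: eq_integral => a _.
  by rewrite patchE mem_setE in_itv/= andbT /f/=; case: ifPn.
rewrite fubini_tonelli// [RHS]integral_mkcond; apply: eq_integral => a _.
rewrite patchE mem_setE in_itv/= andbT; case: ifPn => a0; last first.
  apply: integral0_eq => x _; rewrite /f/= ifF//; apply/negbTE.
  by apply: contra a0 => h; exact: le_trans h.
rewrite -ge0_integralZl//; last 3 first.
- by apply: measurable_funTS; exact/measurable_EFinP.
- by move=> x _; rewrite lee_fin.
- by rewrite lee_fin; apply: cauchy_slope_ge0 => //; exact: ltW.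
rewrite [RHS]integral_mkcond; apply: eq_integral => x _.
rewrite patchE mem_setE in_itv/= -ler_norml /f/=.
by case: ifPn => // _; rewrite mulrC EFinM.
Qed.

End layer_cake.

Section average.
Context {R : realType}.
Local Notation m := (@lebesgue_measure R).

Lemma integrable_cauchy_pdf (u v : R) : 0 < v ->
  m.-integrable setT (EFin \o cauchy_pdf u v).
Proof.
move=> v0; have p0 x : 0 <= cauchy_pdf u v x by exact/cauchy_pdf_ge0/ltW.
apply/integrableP; split; first by apply/measurable_EFinP;
  exact: measurable_cauchy_pdf.
by under eq_integral do rewrite gee0_abs ?lee_fin//;
  rewrite integral_cauchy_pdf// ltry.
Qed.

Lemma Rintegral_cauchy_pdf (u v : R) : 0 < v -> \int[m]_x cauchy_pdf u v x = 1.
Proof. by move=> v0; rewrite /Rintegral integral_cauchy_pdf. Qed.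

Variables (F : R -> R) (M : R).
Hypothesis mF : measurable_fun [set: R] F.
Hypothesis F0 : forall x, 0 <= F x.
Hypothesis FM : forall x, F x <= M.

Let M0 : 0 <= M. Proof. exact: le_trans (F0 0) (FM 0). Qed.

Let absFM x : `|F x| <= M. Proof. by rewrite ger0_norm. Qed.

Let iF (a : R) : m.-integrable `[(- a)%R, a] (EFin \o F).
Proof. exact: integrable_bounded_itv mF absFM. Qed.

Let S (a : R) := \int[m]_(x in `[(- a)%R, a]) F x.

Let SE (a : R) : (\int[m]_(x in `[(- a)%R, a]) (F x)%:E)%E = (S a)%:E.
Proof. by rewrite /S /Rintegral fineK//; exact: integrable_fin_num. Qed.

Lemma Rintegral_sym_itv_le (a : R) : 0 <= a ->
  \int[m]_(x in `[(- a)%R, a]) F x <= 2 * a * M.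
Proof.
move=> a0; rewrite -/(S a) -lee_fin -SE.
apply: (@le_trans _ _ (\int[m]_(x in `[(- a)%R, a]) (cst M%:E x))%E).
  apply: ge0_le_integral => //.
  - by move=> x _; rewrite lee_fin.
  - by apply: measurable_funTS; exact/measurable_EFinP.
  - by move=> x _; rewrite lee_fin.
rewrite integral_cst//= lebesgue_measure_itv/= lte_fin.
case: ifPn => _; last by rewrite mule0 lee_fin !mulr_ge0.
by rewrite -EFinB -EFinM lee_fin opprK mulrC ler_wpM2r// mulr2n mulrDl mul1r.
Qed.

Let mS D : measurable D -> measurable_fun D S.
Proof.
move=> mD; apply: nondecreasing_measurable => // a b ab.
rewrite -lee_fin -!SE; apply: ge0_subset_integral => //.
- by apply: measurable_funTS; exact/measurable_EFinP.
- by move=> x _; rewrite lee_fin.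
- by apply: subset_itv; rewrite leBSide//= lerN2.
Qed.

Local Notation E := (`[0, +oo[%classic : set R).
(** [ge0_integral_cauchy_layer] for a bounded function, in terms of real
    integrals. *)
Lemma ge0_Rintegral_cauchy_layer v : 0 < v ->
  m.-integrable E (EFin \o
    (fun a => cauchy_slope v a * \int[m]_(x in `[(- a)%R, a]) F x)) /\
  \int[m]_x (F x * cauchy_pdf 0 v x) =
  \int[m]_(a in E) (cauchy_slope v a * \int[m]_(x in `[(- a)%R, a]) F x).
Proof.
move=> v0.
have e : (\int[m]_x (F x * cauchy_pdf 0 v x)%:E =
    \int[m]_(a in E) (cauchy_slope v a * S a)%:E)%E.
  rewrite ge0_integral_cauchy_layer//; apply: eq_integral => a _.
  by rewrite SE EFinM.
split; last by rewrite /Rintegral e.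
apply/integrableP; split.
  apply/measurable_EFinP; apply: measurable_funM; last first.
    by apply: mS; exact: measurable_itv.
  by apply: measurable_funTS; exact: measurable_cauchy_slope.
under eq_integral.
  move=> a; rewrite inE/= in_itv/= andbT => a0.
  rewrite ger0_norm; last first.
    by rewrite mulr_ge0 ?Rintegral_ge0//; apply: cauchy_slope_ge0 => //;
      exact: ltW.
  over.
rewrite -e; apply: integrable_lty => //.
exact: (lebesgue_integrable_mul mF absFM (integrable_cauchy_pdf 0 v0)).
Qed.

End average.

Section average.
Context {R : realType}.
Local Notation m := (@lebesgue_measure R).
Local Notation E := (`[0, +oo[%classic : set R).

(** The layer cake formula for the constant [1]: the weights
    [cauchy_slope v a * (2 * a)] of the uniform distributions on [[-a, a]] have
    total mass [1]. *)
Lemma integral_cauchy_slopeM (v : R) : 0 < v ->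
  m.-integrable E (EFin \o (fun a => cauchy_slope v a * (2 * a))) /\
  \int[m]_(a in E) (cauchy_slope v a * (2 * a)) = 1.
Proof.
move=> v0.
have ES : {in E, (fun a => cauchy_slope v a *
  \int[m]_(x in `[(- a)%R, a]) cst 1 x)
    =1 (fun a => cauchy_slope v a * (2 * a))}.
  move=> a /[!inE]/=; rewrite in_itv/= andbT => a0; congr (_ * _).
  rewrite Rintegral_cst//= mul1r lebesgue_measure_itv/= lte_fin.
  case: ltP => [_|aa]; first by rewrite -EFinB/= opprK mulr2n mulrDl mul1r.
  by have -> : a = 0 by [apply/eqP; rewrite eq_le a0 andbT; lra]; rewrite mulr0.
have [] := @ge0_Rintegral_cauchy_layer R (cst 1) 1 _ _ _ v v0 => //.
move=> i1 i2; split.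
  apply: eq_integrable i1 => // a aE /=; congr (_%:E); exact: ES.
rewrite -(eq_Rintegral m ES) -i2 -[RHS](Rintegral_cauchy_pdf 0 v0).
by apply: eq_Rintegral => x _; rewrite /= mul1r.
Qed.

Variables (F : R -> R) (M l : R).
Hypothesis mF : measurable_fun [set: R] F.
Hypothesis F0 : forall x, 0 <= F x.
Hypothesis FM : forall x, F x <= M.
Hypothesis avgF :
  ((2 * a)^-1 * \int[m]_(x in `[(- a)%R, a]) F x) @[a --> +oo] --> l.

Let M0 : 0 <= M. Proof. exact: le_trans (F0 0) (FM 0). Qed.

Let S (a : R) := \int[m]_(x in `[(- a)%R, a]) F x.

(** A Cauchy density of large scale averages [F] almost as the uniform
    distribution on a large interval does. *)
Lemma cauchy_average e : 0 < e -> exists V : R,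
  forall v, V <= v -> `|\int[m]_x (F x * cauchy_pdf 0 v x) - l| <= e.
Proof.
move=> e0.
have /cvgrPdist_le/(_ _ (divr_gt0 e0 (ltr0n R 2)))[A0 [A0r hA]] := avgF.
(* beyond [A] the averages over [[-a, a]] are [e / 2]-close to [l] *)
pose A := Num.max A0 1 + 1.
have A1 : 1 <= A by rewrite /A lerDr le_max ler01 orbT.
have AA0 : A0 < A by rewrite /A ltr_pwDr// le_max lexx.
have hS a : A <= a -> `|S a - 2 * a * l| <= e / 2 * (2 * a).
  move=> Aa.
  have a0 : 0 < 2 * a by rewrite mulr_gt0//; apply: lt_le_trans Aa;
    exact: lt_le_trans A1.
  have -> : S a - 2 * a * l = ((2 * a)^-1 * S a - l) * (2 * a).
    by rewrite [RHS]mulrBl [X in _ = X - _]mulrAC mulVf ?gt_eqF// mul1r [l *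
      _]mulrC.
  rewrite normrM (gtr0_norm a0) ler_wpM2r//; first exact: ltW.
  by rewrite distrC; apply: hA; exact: lt_le_trans Aa.
pose N := M + `|l|.
have N0 : 0 <= N by rewrite addr_ge0.
(* the layers [a <= A] contribute at most [c / v ^+ 3 <= c / v] *)
pose c := 2 * A * N * (2 * A) / pi * A.
have c0 : 0 <= c.
  rewrite /c !mulr_ge0 ?invr_ge0 ?pi_ge0//; exact: le_trans A1.
exists (Num.max 1 (c / (e / 2))) => v; rewrite ge_max => /andP[v1 cv].
have v0 : 0 < v by exact: lt_le_trans v1.
have [iD eD] := ge0_Rintegral_cauchy_layer mF F0 FM v0.
have [iK eK] := integral_cauchy_slopeM v0.
pose K a : R := cauchy_slope v a * (2 * a).
pose D a : R := cauchy_slope v a * S a.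
have k0 a : E a -> 0 <= cauchy_slope v a.
  by rewrite /= in_itv/= andbT => a0; apply: cauchy_slope_ge0 => //; exact: ltW.
pose B := 2 * A * N * (2 * A) / (pi * v ^+ 3).
have B0 : 0 <= B.
  rewrite /B !mulr_ge0 ?invr_ge0 ?mulr_ge0 ?pi_ge0 ?exprn_ge0 ?(ltW v0)//;
    exact: le_trans A1.
pose I : set R := `[0, A]%classic.
pose H a : R := e / 2 * K a + B * \1_I a.
have mE : measurable (E : set (measurableTypeR R)) by exact: measurable_itv.
have mI : measurable (I : set (measurableTypeR R)) by exact: measurable_itv.
have iK2 (r : R) : m.-integrable E (EFin \o (fun a => r * K a)).
  exact: (integrableZl mE r iK).
have iI : m.-integrable E (EFin \o (fun a => B * \1_I a)).
  apply: (integrableZl mE B (f := EFin \o \1_I)).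
  exact: (integrableS measurableT mE (@subsetT _ _) (integrable_indic_itv 0 A
    true false)).
have iDK : m.-integrable E (EFin \o (fun a => D a - l * K a)).
  exact: (integrableB mE iD (iK2 l)).
have iH : m.-integrable E (EFin \o H).
  exact: (integrableD mE (iK2 (e / 2)) iI).
have DKH a : E a -> `|D a - l * K a| <= H a.
  move=> Ea; have ka := k0 a Ea; move: Ea; rewrite /= in_itv/= andbT => a0.
  rewrite /D /K mulrCA -mulrBr normrM (ger0_norm ka) [l * _]mulrC.
  have [Aa|aA] := leP A a.
    apply: (@le_trans _ _ (e / 2 * K a)).
      by rewrite /K mulrCA ler_wpM2l// hS.
    by rewrite lerDl mulr_ge0.
  rewrite /H; have -> : \1_I a = 1 :> R
    by rewrite indicE mem_set// /I/= in_itv/= a0 ltW.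
  rewrite mulr1 -[leLHS]add0r lerD//.
    by apply: mulr_ge0; [rewrite divr_ge0// ltW|rewrite /K mulr_ge0// mulr_ge0].
  have p3 : 0 < (pi : R) * v ^+ 3 by rewrite mulr_gt0 ?pi_gt0// exprn_gt0.
  have ha : cauchy_slope v a <= 2 * A / (pi * v ^+ 3).
    apply: le_trans (cauchy_slope_le v0 a0) _.
    by rewrite ler_wpM2r ?invr_ge0 ?(ltW p3)// ler_wpM2l// ltW.
  have hb : `|S a - 2 * a * l| <= 2 * A * N.
    apply: (@le_trans _ _ (2 * a * N));
      last by rewrite ler_wpM2r// ler_wpM2l// ltW.
    rewrite /N mulrDr; apply: le_trans (ler_normB _ _) _; rewrite lerD//.
      by rewrite ger0_norm ?Rintegral_ge0//; exact: Rintegral_sym_itv_le.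
    by rewrite normrM ger0_norm// mulr_ge0.
  by rewrite /B [leLHS]mulrC -[leRHS]mulrA ler_pM.
rewrite eD.
have eKz (r : R) : \int[m]_(a in E) (r * K a) = r.
  by have := RintegralZl r mE iK; rewrite eK mulr1.
have eDK : \int[m]_(a in E) (D a - l * K a) = \int[m]_(a in E) D a - l.
  by rewrite -[X in _ = _ - X]eKz; exact: (RintegralB mE iD (iK2 l)).
rewrite -[X in X - l]/(\int[m]_(a in E) D a) -eDK.
apply: le_trans (le_normr_Rintegral mE iDK) _.
apply: (@le_trans _ _ (\int[m]_(a in E) H a)).
  apply: le_Rintegral => //; first exact: (integrable_norm iDK).
have -> : \int[m]_(a in E) H a = e / 2 + \int[m]_(a in E) (B * \1_I a).
  by rewrite -[X in _ = X + _]eKz; exact: (RintegralD mE (iK2 (e / 2)) iI).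
have -> : \int[m]_(a in E) (B * \1_I a) = B * A.
  have iI1 : m.-integrable E (EFin \o \1_I).
    exact: (integrableS measurableT mE (@subsetT _ _) (integrable_indic_itv 0 A
      true false)).
  rewrite (RintegralZl B mE iI1); congr (_ * _).
  rewrite /Rintegral integral_indic// setIidl; last first.
    by move=> x; rewrite /I/= !in_itv/= => /andP[-> _].
  have mIA : m `[0, A]%classic = A%:E.
    by rewrite lebesgue_measure_itv/= lte_fin (lt_le_trans _ A1)// -EFinB subr0.
  by rewrite -[LHS]/(fine (m `[0, A]%classic)) mIA.
rewrite [leRHS]splitr lerD2l.
have -> : B * A = c / v ^+ 3.
  rewrite /B /c; move: (pi : R) (lt0r_neq0 (pi_gt0 R)) => p p0.
  by field; rewrite p0 gt_eqF.
rewrite ler_pdivrMr ?exprn_gt0//.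
move: cv; rewrite ler_pdivrMr ?divr_gt0// => cv.
apply: le_trans cv _; rewrite mulrC ler_wpM2l//;
  first by rewrite divr_ge0// ltW.
by rewrite -[leLHS]expr1; apply: ler_weXn2l.
Qed.

End average.

Section cauchy_limit.
Context {R : realType}.
Local Notation m := (@lebesgue_measure R).

Lemma cauchy_pdf_shift (u v x : R) : 0 < v ->
  `|cauchy_pdf u v x - cauchy_pdf 0 v x| <=
  `|u| / (2 * v) * (cauchy_pdf u v x + cauchy_pdf 0 v x).
Proof.
move=> v0; rewrite /cauchy_pdf subr0.
have p0 : 0 < (pi : R) by exact: pi_gt0.
set p := (x - u) ^+ 2 + v ^+ 2; set q := x ^+ 2 + v ^+ 2.
have pp : 0 < p by rewrite /p ltr_wpDl ?sqr_ge0// exprn_gt0.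
have qp : 0 < q by rewrite /q ltr_wpDl ?sqr_ge0// exprn_gt0.
have E1 : v / (pi * p) - v / (pi * q) = (v * u * (x + (x - u))) / (pi * p * q).
  have -> : v * u * (x + (x - u)) = v * (q - p) by rewrite /p /q; ring.
  move: (pi : R) p0 => c c0; clearbody p q.
  by field; rewrite !gt_eqF.
have E2 : `|u| / (2 * v) * (v / (pi * p) + v / (pi * q)) =
    (`|u| * ((p + q) / 2)) / (pi * p * q).
  move: (pi : R) p0 => c c0; clearbody p q.
  by field; rewrite !gt_eqF.
rewrite E1 E2 normrM (ger0_norm (x := (pi * p * q)^-1)); last first.
  by rewrite invr_ge0 !mulr_ge0 ?(ltW p0) ?(ltW pp) ?(ltW qp).
rewrite ler_wpM2r ?invr_ge0 ?mulr_ge0 ?(ltW p0) ?(ltW pp) ?(ltW qp)//.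
rewrite [v * u]mulrC -mulrA normrM ler_wpM2l// normrM (gtr0_norm v0).
apply: (@le_trans _ _ (v * (`|x| + `|x - u|))).
  by rewrite ler_wpM2l ?ler_normD// ltW.
have h (y : R) : v * `|y| <= (y ^+ 2 + v ^+ 2) / 2.
  have := sqr_ge0 (v - `|y|); rewrite sqrrB real_normK ?num_real// mulr2n; lra.
have := h x; have := h (x - u); rewrite -/p -/q mulrDr; lra.
Qed.

Variables (F : R -> R) (M l : R).
Hypothesis mF : measurable_fun [set: R] F.
Hypothesis F0 : forall x, 0 <= F x.
Hypothesis FM : forall x, F x <= M.

Let M0 : 0 <= M. Proof. exact: le_trans (F0 0) (FM 0). Qed.

Let absFM x : `|F x| <= M. Proof. by rewrite ger0_norm. Qed.

Let iFC (u v : R) : 0 < v ->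
  m.-integrable setT (EFin \o (fun x => F x * cauchy_pdf u v x)).
Proof. by move=> v0; exact: (lebesgue_integrable_mul mF absFM
  (integrable_cauchy_pdf u v0)). Qed.

(** The [L^1] distance between the densities with locations [u] and [0] is at
    most [|u| / v]. *)
Lemma Rintegral_cauchy_shift (u v : R) : 0 < v ->
  `|\int[m]_x (F x * cauchy_pdf u v x) - \int[m]_x (F x * cauchy_pdf 0 v x)|
  <= M * (`|u| / v).
Proof.
move=> v0; rewrite -(RintegralB measurableT (iFC u v0) (iFC 0 v0)).
have iB := integrableB measurableT (iFC u v0) (iFC 0 v0).
apply: le_trans (le_normr_Rintegral measurableT iB) _.
have iP := integrableD measurableT (integrable_cauchy_pdf u v0)
  (integrable_cauchy_pdf 0 v0).
pose k := M * (`|u| / (2 * v)).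
apply: (@le_trans _ _ (\int[m]_x (k * (cauchy_pdf u v x + cauchy_pdf 0 v x)))).
  apply: le_Rintegral => //.
  - exact: (integrable_norm iB).
  - exact: (integrableZl measurableT k iP).
  - move=> x _; rewrite -mulrBr normrM /k -mulrA ler_pM//.
    exact: cauchy_pdf_shift.
rewrite (RintegralZl k measurableT iP).
have -> : \int[m]_x (cauchy_pdf u v x + cauchy_pdf 0 v x) = 2.
  rewrite (RintegralD measurableT (integrable_cauchy_pdf u v0)
    (integrable_cauchy_pdf 0 v0)).
  by rewrite !Rintegral_cauchy_pdf.
rewrite le_eqVlt; apply/orP; left; apply/eqP; rewrite /k.
by field; rewrite gt_eqF.
Qed.

Hypothesis avgF :
  ((2 * a)^-1 * \int[m]_(x in `[(- a)%R, a]) F x) @[a --> +oo] --> l.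

Lemma cvg_cauchy_average (u v : nat -> R) (U : R) : (forall n, 0 < v n) ->
  (forall n, `|u n| <= U) -> v n @[n --> \oo] --> +oo ->
  \int[m]_x (F x * cauchy_pdf (u n) (v n) x) @[n --> \oo] --> l.
Proof.
move=> v0 uU vy; apply/cvgrPdist_le => e e0.
have e2 : 0 < e / 2 by rewrite divr_gt0.
have [V hV] := cauchy_average mF F0 FM avgF e2.
near=> n.
have vV : V <= v n by near: n; move/cvgryPge : vy; apply.
have vW : M * U / (e / 2) <= v n by near: n; move/cvgryPge : vy; apply.
rewrite distrC -(subrKA (\int[m]_x (F x * cauchy_pdf 0 (v n) x))) [leRHS]splitr.
apply: le_trans (ler_normD _ _) _; apply: lerD; last exact: hV.
apply: le_trans (Rintegral_cauchy_shift _ (v0 n)) _.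
rewrite mulrA ler_pdivrMr// (le_trans (y := M * U))//;
  first by rewrite ler_wpM2l.
by rewrite [leRHS]mulrC -ler_pdivrMr.
Unshelve. all: by end_near. Qed.

(** Global-local mixing when the local observable is a Cauchy density. *)
Lemma cvg_boole_cauchy (u v : R) : 0 < v ->
  \int[m]_x (F (iter n (@boole_map R) x) * cauchy_pdf u v x) @[n --> \oo] --> l.
Proof.
move=> v0; pose w := (u, v).
have w0 : 0 < w.2 by [].
under eq_cvg.
  move=> n; rewrite /Rintegral.
  rewrite (@ge0_integral_iter_boole_cauchy _ n u v (EFin \o F))//;
    last exact/measurable_EFinP.
  over.
apply: (cvg_cauchy_average (u := fun n => (iter n (@boole_hp R) w).1)
  (v := fun n => (iter n (@boole_hp R) w).2)).
- by move=> n; exact: iter_boole_hp_gt0.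
- by move=> n; exact: iter_boole_hp_re_le.
- exact: iter_boole_hp_cvgy.
Qed.

End cauchy_limit.

(** * Weak convergence on a dense subspace *)

Section weak_convergence.
Context {R : realType}.
Local Notation m := (@lebesgue_measure R).
Variables (phi : nat -> R -> R) (M l : R).
Hypothesis mphi : forall n, measurable_fun [set: R] (phi n).
Hypothesis phiM : forall n x, `|phi n x| <= M.

(** The sequence [phi], seen as a sequence of functionals on [L^1], converges to
    [l] times the Lebesgue integral at the integrable function [g]. *)
Definition weak_cvg_at (g : R -> R) : Prop :=
  m.-integrable setT (EFin \o g) /\
  \int[m]_x (phi n x * g x) @[n --> \oo] --> l * \int[m]_x g x.

Let M0 : 0 <= M. Proof. exact: le_trans (phiM 0%N 0). Qed.

Let iphi n (g : R -> R) : m.-integrable setT (EFin \o g) ->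
  m.-integrable setT (EFin \o (fun x => phi n x * g x)).
Proof. by move=> ig; exact: (lebesgue_integrable_mul (mphi n) (phiM n) ig). Qed.

Lemma weak_cvg_at_lim (g : R -> R) : m.-integrable setT (EFin \o g) ->
  (forall e, 0 < e -> exists2 h, weak_cvg_at h & \int[m]_x `|g x - h x| <= e) ->
  weak_cvg_at g.
Proof.
move=> ig gh; split => //; apply/cvgrPdist_le => e e0.
pose d := e / (M + 1 + `|l|).
have N0 : 0 < M + 1 + `|l| by rewrite ltr_wpDr// ltr_wpDl.
have d0 : 0 < d by rewrite divr_gt0.
have [h [ih ch] ghd] := gh d d0.
have igh := integrableB measurableT ig ih.
move/cvgrPdist_le : ch => /(_ d d0) ch.
near=> n.
have hn : `|l * \int[m]_x h x - \int[m]_x (phi n x * h x)| <= d by near: n.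
have h1 : `|\int[m]_x g x - \int[m]_x h x| <= d.
  rewrite -(RintegralB measurableT ig ih).
  exact: le_trans (le_normr_Rintegral measurableT igh) ghd.
have h2 : `|\int[m]_x (phi n x * g x) - \int[m]_x (phi n x * h x)| <= M * d.
  rewrite -(RintegralB measurableT (iphi n ig) (iphi n ih)).
  have iB := integrableB measurableT (iphi n ig) (iphi n ih).
  apply: le_trans (le_normr_Rintegral measurableT iB) _.
  have iN : m.-integrable setT (EFin \o (fun x => `|g x - h x|)).
    exact: (integrable_norm igh).
  apply: (@le_trans _ _ (\int[m]_x (M * `|g x - h x|))).
    apply: le_Rintegral => //.
    - exact: (integrable_norm iB).
    - exact: (integrableZl measurableT M iN).
    - by move=> x _; rewrite -mulrBr normrM ler_wpM2r.
  by rewrite (RintegralZl M measurableT iN) ler_wpM2l.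
have -> : l * \int[m]_x g x - \int[m]_x (phi n x * g x) =
  l * (\int[m]_x g x - \int[m]_x h x)
  + (l * \int[m]_x h x - \int[m]_x (phi n x * h x))
  - (\int[m]_x (phi n x * g x) - \int[m]_x (phi n x * h x)).
  move: (\int[m]_x g x) (\int[m]_x h x) (\int[m]_x (phi n x * g x))
    (\int[m]_x (phi n x * h x)) => A B C D; ring.
have -> : e = `|l| * d + d + M * d.
  by rewrite /d; field; rewrite gt_eqF.
apply: le_trans (ler_normB _ _) _; apply: lerD => //.
apply: le_trans (ler_normD _ _) _; apply: lerD => //.
by rewrite normrM ler_wpM2l.
Unshelve. all: by end_near. Qed.

Lemma weak_cvg_atD (g h : R -> R) : weak_cvg_at g -> weak_cvg_at h ->
  weak_cvg_at (fun x => g x + h x).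
Proof.
move=> [ig cg] [ih ch]; split; first exact: (integrableD measurableT ig ih).
rewrite (RintegralD measurableT ig ih) mulrDr.
under eq_cvg.
  move=> n; under eq_Rintegral do rewrite mulrDr.
  rewrite (RintegralD measurableT (iphi n ig) (iphi n ih)).
  over.
exact: cvgD.
Qed.

Lemma weak_cvg_atZ (r : R) (g : R -> R) : weak_cvg_at g ->
  weak_cvg_at (fun x => r * g x).
Proof.
move=> [ig cg]; split; first exact: (integrableZl measurableT r ig).
rewrite (RintegralZl r measurableT ig) mulrCA.
under eq_cvg.
  move=> n; under eq_Rintegral do rewrite mulrCA.
  rewrite (RintegralZl r measurableT (iphi n ig)).
  over.
by apply: cvgM => //; exact: cvg_cst.
Qed.

Lemma eq_weak_cvg_at (g h : R -> R) : g =1 h -> weak_cvg_at g -> weak_cvg_at h.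
Proof. by move=> /funext ->. Qed.

Lemma weak_cvg_atB (g h : R -> R) : weak_cvg_at g -> weak_cvg_at h ->
  weak_cvg_at (fun x => g x - h x).
Proof.
move=> wg wh; apply: (eq_weak_cvg_at _ (weak_cvg_atD wg (weak_cvg_atZ (-1)
  wh))).
by move=> x; rewrite mulN1r.
Qed.

Lemma weak_cvg_at0 : weak_cvg_at (cst 0).
Proof.
split; first exact: (integrable0 _ _).
have i0 : \int[m]_x cst 0 x = 0 :> R by rewrite /Rintegral integral0_eq.
rewrite i0 mulr0; under eq_cvg.
  move=> n; under eq_Rintegral do rewrite mulr0.
  rewrite -/(\int[m]_x cst 0 x) i0.
  over.
exact: cvg_cst.
Qed.

Lemma weak_cvg_at_sum (I : Type) (s : seq I) (g : I -> R -> R) :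
  (forall i, weak_cvg_at (g i)) -> weak_cvg_at (fun x => \sum_(i <- s) g i x).
Proof.
move=> wg; elim: s => [|i s ih].
  by apply: (eq_weak_cvg_at _ weak_cvg_at0) => x; rewrite big_nil.
apply: (eq_weak_cvg_at _ (weak_cvg_atD (wg i) ih)) => x.
by rewrite big_cons.
Qed.

Lemma weak_cvg_at_indic_bigcup (B : nat -> set R) :
  nondecreasing_seq B -> (forall n, measurable (B n)) ->
  m.-integrable setT (EFin \o \1_(\bigcup_n B n)) ->
  (forall n, weak_cvg_at \1_(B n)) -> weak_cvg_at \1_(\bigcup_n B n).
Proof.
move=> ndB mB iB wB; apply: weak_cvg_at_lim => // e e0.
have mU : measurable (\bigcup_n B n) by exact: bigcup_measurable.
have cB : \int[m]_x \1_(B n) x @[n --> \oo] --> \int[m]_x \1_(\bigcup_n B n) x.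
  have indE (A : set R) : measurable A -> \int[m]_x \1_A x = fine (m A).
    by move=> mA; rewrite /Rintegral integral_indic// setIT.
  rewrite indE//; under eq_cvg do rewrite indE//.
  apply: fine_cvg; rewrite fineK; first exact: nondecreasing_cvg_mu.
  rewrite -[X in m X]setIT -(integral_indic m measurableT mU).
  exact: (integrable_fin_num measurableT iB).
move/cvgrPdist_le : cB => /(_ e e0) [N _ hN].
exists \1_(B N) => //.
apply: le_trans (hN N (leqnn N)).
rewrite -(RintegralB measurableT iB (wB N).1).
apply: le_trans (ler_norm _); rewrite le_eqVlt; apply/orP; left; apply/eqP.
apply: eq_Rintegral => x _; rewrite ger0_norm// subr_ge0.
rewrite !indicE ler_nat; case: (boolP (x \in B N)) => //= /[!inE] xB.
by rewrite mem_set//; exists N.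
Qed.

Hypothesis weak_itv : forall a b : R, weak_cvg_at \1_(`]a, b]%classic).

Let I (k : nat) : set R := `](- k%:R), k%:R]%classic.

Let mI k : measurable (I k). Proof. exact: measurable_itv. Qed.

Let ndI (A : set R) : nondecreasing_seq (fun k => A `&` I k).
Proof.
move=> i j ij; apply/subsetPset; apply: setIS; apply: subset_itv.
  by rewrite leBSide/= lerN2 ler_nat.
by rewrite leBSide/= ler_nat.
Qed.

Let UI (A : set R) : \bigcup_k (A `&` I k) = A.
Proof.
by rewrite -setI_bigcupr bigcup_itvoc_sym setIT.
Qed.

Let indicS (A B : set R) : measurable A -> measurable B ->
  m.-integrable setT (EFin \o \1_A) -> B `<=` A ->
  m.-integrable setT (EFin \o \1_B).
Proof.
move=> mA mB iA BA; apply: le_integrable iA => //.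
  by apply/measurable_EFinP; exact: measurable_indic.
move=> x _ /=; rewrite lee_fin !ger0_norm// !indicE ler_nat.
by case: (boolP (x \in B)) => //= /[!inE] xB; rewrite mem_set//; exact: BA.
Qed.

(** A lambda-system on the line contains the whole line, whose indicator is not
    integrable; hence the intersections with the bounded intervals [I k]. *)
Let lambdaH :
  lambda_system setT [set A : set R | measurable A /\ forall k,
    weak_cvg_at \1_(A `&` I k)].
Proof.
split => //=.
- by split => // k; rewrite setTI; exact: weak_itv.
- move=> A B BA [mA wA] [mB wB]; split; first exact: measurableD.
  move=> k; apply: (eq_weak_cvg_at _ (weak_cvg_atB (wA k) (wB k))) => x.
  rewrite -[RHS](addrK (\1_(B `&` I k) x)); congr (_ - _).
  rewrite setDE !indicE !in_setI in_setC -natrD; congr (_%:R).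
  case: (boolP (x \in B)) => [xB|xB]; last by rewrite andbT addn0.
  have -> : x \in A by move: xB; rewrite !inE; exact: BA.
  by case: (x \in I k).
- move=> B ndB wB.
  have mB n : measurable (B n) by have [] := wB n.
  split; first exact: bigcup_measurable.
  move=> k; rewrite setI_bigcupl.
  have mBk n : measurable (B n `&` I k) by apply: measurableI => //; exact: mI.
  apply: weak_cvg_at_indic_bigcup => //.
  + by move=> i j ij; apply/subsetPset; apply: setSI; apply/subsetPset;
      exact: ndB.
  + apply: (indicS _ _ (weak_itv (- k%:R) k%:R).1) => //.
      exact: bigcup_measurable.
    by move=> x [n _ []].
  + by move=> n; have [_] := wB n; exact.
Qed.

Lemma weak_cvg_at_indic (A : set R) : measurable A ->
  m.-integrable setT (EFin \o \1_A) -> weak_cvg_at \1_A.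
Proof.
move=> mA iA.
have HA := lambda_system_subset (@ocitvI R) lambdaH.
have {HA} [_ wA] : [set A : set R | measurable A /\ forall k, weak_cvg_at \1_(A
  `&` I k)] A.
  apply: HA => //.
  move=> _ [[a b] _ <-]; split; first exact: measurable_itv.
  move=> k; have [[c d] _ <-] := @ocitvI R `]a, b]%classic (I k) (is_ocitv _ _)
    (is_ocitv _ _).
  exact: weak_itv.
rewrite -(UI A); apply: weak_cvg_at_indic_bigcup => //.
- by move=> n; apply: measurableI => //; exact: mI.
- by rewrite UI.
Qed.

Import HBSimple.

Lemma weak_cvg_at_sfun (h : {sfun (measurableTypeR R) >-> R}) :
  m.-integrable setT (EFin \o h) -> weak_cvg_at h.
Proof.
move=> ih.
pose s := finmap.enum_fset (fset_set (range h)).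
have hE x : h x = \sum_(r <- s) r * \1_(h @^-1` [set r]) x.
  by rewrite fimfunE fsbig_finite.
apply: (eq_weak_cvg_at (g := fun x => \sum_(r <- s) r *
  \1_(h @^-1` [set r]) x)).
  by move=> x; rewrite hE.
apply: weak_cvg_at_sum => r.
have [->|r0] := eqVneq r 0.
  by apply: (eq_weak_cvg_at _ weak_cvg_at0) => x; rewrite mul0r.
have mA : measurable (h @^-1` [set r]).
  by rewrite -[_ @^-1` _]setTI; exact: (measurable_funP h).
apply: weak_cvg_atZ; apply: weak_cvg_at_indic => //.
have := integrableZl measurableT r^-1 ih.
apply: le_integrable => //.
  by apply/measurable_EFinP/measurable_indic.
move=> x _ /=; rewrite lee_fin indicE.
case: (boolP (x \in _)) => [|_]; last by rewrite normr0.
by rewrite inE/= => ->; rewrite mulVf.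
Qed.

Lemma weak_cvg_at_integrable (g : R -> R) : m.-integrable setT (EFin \o g) ->
  weak_cvg_at g.
Proof.
move=> ig; apply: weak_cvg_at_lim => // e e0.
have [h [ih _ /fine_cvgP[_ /cvgrPdist_le/(_ _ e0)]]] :=
  approximation_sfun_integrable measurableT ig.
move=> [N _ /(_ N (leqnn N))] /=; rewrite sub0r normrN => hN.
exists (h N); first exact: weak_cvg_at_sfun.
exact: le_trans (ler_norm _) hN.
Qed.

End weak_convergence.

(** * Approximation of intervals by mixtures of Cauchy densities *)

Section cauchy_smoothing.
Context {R : realType}.
Local Notation m := (@lebesgue_measure R).
Variables (a b : R).
Hypothesis ab : a < b.
Let I : set R := `]a, b]%classic.

(** For [y > 0], the integral of [cauchy_pdf x y t] over the locations [x] in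
    [`]a, b]], as a function of [t].  As [cauchy_pdf x y t = cauchy_pdf t y x],
    it is the mass of [`]a, b]] for the Cauchy law with location [t] and scale
    [y], and so it has a closed form. *)
Definition cauchy_smooth (y t : R) : R := cauchy_cdf t y b - cauchy_cdf t y a.

Let mI : measurable (I : set (measurableTypeR R)).
Proof. exact: measurable_itv. Qed.

Let mIE : m I = (b - a)%:E.
Proof. by rewrite /I lebesgue_measure_itv/= lte_fin ab -EFinB. Qed.

Lemma cauchy_smooth_ge0 y t : 0 < y -> 0 <= cauchy_smooth y t.
Proof. by move=> y0; rewrite subr_ge0 le_cauchy_cdf// ltW. Qed.

Lemma cauchy_smooth_le1 y t : 0 < y -> cauchy_smooth y t <= 1.
Proof.
move=> y0; rewrite -lee_fin /cauchy_smooth -integral_cauchy_pdf_itvoc//;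
  last exact: ltW.
rewrite -(integral_cauchy_pdf t y0); apply: ge0_subset_integral => //.
- by apply/measurable_EFinP; exact: measurable_cauchy_pdf.
- by move=> x _; rewrite lee_fin cauchy_pdf_ge0// ltW.
Qed.

Lemma measurable_cauchy_smooth y : measurable_fun [set: R] (cauchy_smooth y).
Proof.
have mc (c : R) : measurable_fun [set: R] (fun t => cauchy_cdf t y c).
  apply: measurable_funM => //; apply: (measurableT_comp (f := @atan R)).
    by apply: continuous_measurable_fun => x; exact: continuous_atan.
  by apply: measurable_funM => //; exact: measurable_funB.
by apply: measurable_funB; exact: mc.
Qed.

Section tonelli.
Variable f : R -> R.
Hypothesis mf : measurable_fun [set: R] f.
Hypothesis f0 : forall x, 0 <= f x.
Variable y : R.
Hypothesis y0 : 0 < y.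

Let F (z : measurableTypeR R * measurableTypeR R) : \bar R :=
  (f z.2 * cauchy_pdf z.1 y z.2)%:E.

Let F0 z : (0 <= F z)%E.
Proof. by rewrite lee_fin mulr_ge0// cauchy_pdf_ge0// ltW. Qed.

Let mF : measurable_fun [set: measurableTypeR R * measurableTypeR R] F.
Proof.
apply/measurable_EFinP; apply: measurable_funM.
  by apply: (measurableT_comp mf).
by apply: measurable_cauchy_pdf.
Qed.

Lemma measurable_integral_cauchy :
  measurable_fun [set: R] (fun x => \int[m]_t (f t * cauchy_pdf x y t)%:E)%E.
Proof. exact: (@measurable_fun_fubini_tonelli_F _ _ _ _ _ m F mF F0). Qed.

Lemma integral_cauchy_smooth :
  (\int[m]_t (f t * cauchy_smooth y t)%:E =
   \int[m]_(x in I) \int[m]_t (f t * cauchy_pdf x y t)%:E)%E.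
Proof.
pose G (z : measurableTypeR R * measurableTypeR R) : \bar R :=
  (F z * (\1_I z.1)%:E)%E.
have G0 z : (0 <= G z)%E by rewrite mule_ge0// lee_fin.
have mG : measurable_fun [set: measurableTypeR R * measurableTypeR R] G.
  apply: emeasurable_funM => //; apply/measurable_EFinP.
  exact: (measurableT_comp (@measurable_indic _ (measurableTypeR R) R setT I
    mI) measurable_fst).
transitivity (\int[m]_t \int[m]_x G (x, t))%E.
  apply: eq_integral => t _.
  rewrite EFinM /cauchy_smooth -integral_cauchy_pdf_itvoc//; last exact: ltW.
  rewrite -ge0_integralZl//; last 3 first.
  - by apply: measurable_funTS; apply/measurable_EFinP;
      exact: measurable_cauchy_pdf.
  - by move=> x _; rewrite lee_fin cauchy_pdf_ge0// ltW.
  - by rewrite lee_fin.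
  rewrite integral_mkcond epatch_indic; apply: eq_integral => x _ /=.
  by rewrite /G /F/= -EFinM (cauchy_pdfC t).
rewrite -(@fubini_tonelli _ _ _ _ R m m G mG G0) [RHS]integral_mkcond
  epatch_indic; apply: eq_integral => x _ /=.
rewrite /G /F/= ge0_integralZr//.
- by apply/measurable_EFinP; apply: measurable_funM;
    [exact: mf|exact: measurable_cauchy_pdf].
- by move=> t _; rewrite lee_fin mulr_ge0// cauchy_pdf_ge0// ltW.
Qed.

End tonelli.

Lemma integrable_cauchy_smooth y : 0 < y ->
  m.-integrable setT (EFin \o cauchy_smooth y) /\
  \int[m]_t cauchy_smooth y t = b - a.
Proof.
move=> y0.
have e : (\int[m]_t (cauchy_smooth y t)%:E = (b - a)%:E)%E.
  have := @integral_cauchy_smooth (cst 1) (measurable_cst _) (fun=> ler01) y y0.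
  under eq_integral do rewrite /= mul1r.
  move=> ->; under eq_integral.
    move=> x _; under eq_integral do rewrite /= mul1r.
    rewrite integral_cauchy_pdf//; over.
  by rewrite integral_cst// mul1e.
split; last by rewrite /Rintegral e.
apply/integrableP; split; first by apply/measurable_EFinP;
  exact: measurable_cauchy_smooth.
under eq_integral do rewrite /= ger0_norm ?cauchy_smooth_ge0//.
by rewrite e ltry.
Qed.

Lemma cvg_cauchy_smooth t : a < t < b ->
  cauchy_smooth n.+1%:R^-1 t @[n --> \oo] --> (1 : R).
Proof.
move=> /andP[at_ tb].
have h (c : R) : 0 < c -> atan (c * n.+1%:R) / pi @[n --> \oo] --> (2^-1 : R).
  move=> c0; have -> : 2^-1 = pi / 2 / pi :> R.
    by rewrite mulrAC divff ?mul1r// gt_eqF// pi_gt0.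
  apply: cvgM; last exact: cvg_cst.
  apply: (@cvg_comp _ _ _ (fun n : nat => n.+1%:R : R) (fun x : R =>
    atan (c * x))
      _ (pinfty_nbhs R)).
    by have := @cvgr_idn R; rewrite -cvg_shiftS.
  apply: (@cvg_comp _ _ _ (fun x : R => c * x) (@atan R) _ (pinfty_nbhs R)).
    by apply: (gt0_cvgMry c0); exact: cvg_id.
  exact: cvgy_atan.
rewrite [X in _ --> X](splitr 1) div1r.
under eq_cvg.
  move=> n; rewrite /cauchy_smooth /cauchy_cdf invrK -[a - t]opprB mulNr atanN
    mulNr opprK.
  over.
by apply: cvgD; apply: h; rewrite subr_gt0.
Qed.

Lemma cvg_Rintegral_cauchy_smooth :
  \int[m]_(t in I) cauchy_smooth n.+1%:R^-1 t @[n --> \oo] --> b - a.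
Proof.
have ms n : measurable_fun I (EFin \o cauchy_smooth n.+1%:R^-1).
  by apply: measurable_funTS; apply/measurable_EFinP;
    exact: measurable_cauchy_smooth.
have i1 : m.-integrable I (EFin \o cst (1 : R)).
  apply: measurable_bounded_integrable => //; first by rewrite [ltLHS]mIE ltry.
  by exists 1; split => // x x1 y _; rewrite /= normr1 ltW.
have y0 n : 0 < n.+1%:R^-1 :> R by rewrite invr_gt0.
(* at [t = b] the limit is [1/2] *)
have aecvg : \forall t \ae m, I t ->
    (EFin \o cauchy_smooth n.+1%:R^-1) t @[n --> \oo] --> (EFin \o cst (1 :
      R)) t.
  exists [set b]; split; [exact: measurable_set1|exact: lebesgue_measure_set1|].
  move=> t /= ht; apply: contrapT => tb; apply: ht;
    rewrite /I/= in_itv/= => /andP[ta tle].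
  apply: cvg_EFin; first exact: nearW.
  apply: cvg_cauchy_smooth; rewrite ta lt_neqAle tle andbT/=; exact/eqP.
have dom : \forall t \ae m, forall n, I t ->
    (`|(EFin \o cauchy_smooth n.+1%:R^-1) t| <= (EFin \o cst 1%R) t)%E.
  apply: aeW => t n _ /=.
  by rewrite lee_fin ger0_norm ?cauchy_smooth_ge0 ?cauchy_smooth_le1.
have [_ _] := @dominated_convergence _ _ _ m I mI
  (fun n => EFin \o cauchy_smooth n.+1%:R^-1) (EFin \o cst 1) (EFin \o cst 1)
  ms (measurable_cst 1%E) aecvg i1 dom.
have -> : (\int[m]_(x in I) (EFin \o cst 1%R) x = (b - a)%:E)%E.
  by have := integral_cst m mI 1%E; rewrite [X in (_ * X)%E]mIE mul1e.
by move/fine_cvg.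
Qed.

(** The indicator of [I] and its smoothing have the same integral and the
    smoothing has values in [[0, 1]], so the mass missing inside [I] equals the
    mass in excess outside [I]. *)
Lemma Rintegral_norm_cauchy_smooth y : 0 < y ->
  \int[m]_t `|\1_I t - cauchy_smooth y t| =
  2 * ((b - a) - \int[m]_(t in I) cauchy_smooth y t).
Proof.
move=> y0.
have [i1 e1] := integrable_cauchy_smooth y0.
have iI : m.-integrable setT (EFin \o \1_I)
  by exact: (integrable_indic_itv a b false false).
have eI : \int[m]_t \1_I t = b - a.
  by rewrite /Rintegral integral_indic// setIT [X in fine X]mIE.
have iP : m.-integrable setT (EFin \o (fun t => \1_I t * cauchy_smooth y t)).
  have mind : measurable_fun [set: R] (\1_I : R -> R).
    exact: (@measurable_indic _ (measurableTypeR R) R setT I mI).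
  have ind1 t : `|\1_I t : R| <= 1 by rewrite ger0_norm// indicE;
    case: (_ \in _).
  exact: (lebesgue_integrable_mul mind ind1 i1).
have eP : \int[m]_(t in I) cauchy_smooth y t = \int[m]_t (\1_I t *
  cauchy_smooth y t).
  rewrite Rintegral_mkcond; apply: eq_Rintegral => t _.
  by rewrite patchE indicE; case: ifPn; rewrite ?mul1r ?mul0r.
have iS := integrableD measurableT iI i1.
have i2 : m.-integrable setT (EFin \o (fun t =>
  2 * (\1_I t * cauchy_smooth y t))).
  exact: (integrableZl measurableT 2 iP).
transitivity (\int[m]_t ((\1_I t + cauchy_smooth y t) - 2 * (\1_I t *
  cauchy_smooth y t))).
  apply: eq_Rintegral => t _; rewrite indicE.
  case: (t \in I); rewrite /= ?mul1r ?mul0r.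
    by rewrite ger0_norm ?subr_ge0 ?cauchy_smooth_le1//; ring.
  by rewrite sub0r normrN ger0_norm ?cauchy_smooth_ge0//; ring.
rewrite (RintegralB measurableT iS i2) (RintegralD measurableT iI i1).
rewrite (RintegralZl 2 measurableT iP) eI e1 eP.
by move: (\int[m]_t (\1_I t * cauchy_smooth y t)) => c; ring.
Qed.

End cauchy_smoothing.

(** * Cauchy densities span a dense subspace of [L^1] *)

Section cauchy_dense.
Context {R : realType}.
Local Notation m := (@lebesgue_measure R).
Variables (phi : nat -> R -> R) (M l : R).
Hypothesis mphi : forall n, measurable_fun [set: R] (phi n).
Hypothesis phi0 : forall n x, 0 <= phi n x.
Hypothesis phiM : forall n x, phi n x <= M.
Hypothesis phi_cauchy : forall u v : R, 0 < v ->
  \int[m]_x (phi n x * cauchy_pdf u v x) @[n --> \oo] --> l.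

Let M0 : 0 <= M. Proof. exact: le_trans (phi0 0%N 0) (phiM 0%N 0). Qed.

Let absphi n x : `|phi n x| <= M. Proof. by rewrite ger0_norm. Qed.

Lemma weak_cvg_at_cauchy_smooth (a b y : R) : a < b -> 0 < y ->
  weak_cvg_at phi l (cauchy_smooth a b y).
Proof.
move=> ab y0; have [i1 e1] := integrable_cauchy_smooth ab y0.
split => //; rewrite e1.
set I : set R := `]a, b]%classic.
have mI : measurable (I : set (measurableTypeR R)) by exact: measurable_itv.
have mIE : m I = (b - a)%:E by rewrite /I lebesgue_measure_itv/= lte_fin ab
  -EFinB.
pose psi n x := (\int[m]_t (phi n t * cauchy_pdf x y t)%:E)%E.
have iphi n x : m.-integrable setT (EFin \o (fun t =>
  phi n t * cauchy_pdf x y t)).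
  exact: (lebesgue_integrable_mul (mphi n) (absphi n) (integrable_cauchy_pdf x
    y0)).
have psiE n x : psi n x = (\int[m]_t (phi n t * cauchy_pdf x y t))%:E.
  by rewrite /psi /Rintegral fineK//;
    exact: (integrable_fin_num measurableT (iphi n x)).
have psi_le n x : (`|psi n x| <= M%:E)%E.
  rewrite psiE lee_fin; apply: le_trans (le_normr_Rintegral measurableT (iphi n
    x)) _.
  have iM := integrableZl measurableT M (integrable_cauchy_pdf x y0).
  apply: (@le_trans _ _ (\int[m]_t (M * cauchy_pdf x y t))).
    apply: le_Rintegral => //; first exact: (integrable_norm (iphi n x)).
    move=> t _; have c0 : 0 <= cauchy_pdf x y t by rewrite cauchy_pdf_ge0// ltW.
    by rewrite normrM (ger0_norm c0) ler_wpM2r.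
  rewrite (RintegralZl M measurableT (integrable_cauchy_pdf x y0)).
  by rewrite Rintegral_cauchy_pdf// mulr1.
have mpsi n : measurable_fun I (psi n).
  by apply: measurable_funTS; exact: measurable_integral_cauchy.
have iM : m.-integrable I (EFin \o cst M).
  apply: measurable_bounded_integrable => //; first by rewrite [ltLHS]mIE ltry.
  by exists M; split => [|x Mx]; rewrite ?num_real// => z _ /=;
    rewrite ger0_norm// ltW.
have aecvg : \forall x \ae m, I x -> psi n x @[n --> \oo] --> (EFin \o cst l) x.
  apply: aeW => x _; under eq_cvg do rewrite psiE.
  by apply: cvg_EFin; [exact: nearW|exact: phi_cauchy].
have dom : \forall x \ae m, forall n, I x -> (`|psi n x| <= (EFin \o cst M)
  x)%E.
  by apply: aeW => x n _; exact: psi_le.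
have [_ _] := @dominated_convergence _ _ _ m I mI psi (EFin \o cst l) (EFin \o
  cst M)
  mpsi (measurable_cst l%:E) aecvg iM dom.
have -> : (\int[m]_(x in I) (EFin \o cst l) x = (l * (b - a))%:E)%E.
  by have := integral_cst m mI l%:E; rewrite [X in (_ * X)%E]mIE -EFinM.
move/fine_cvg; apply: cvg_trans; apply: near_eq_cvg; apply: nearW => n /=.
by rewrite /Rintegral (integral_cauchy_smooth ab (mphi n) (phi0 n) y0).
Qed.

Lemma weak_cvg_at_itv (a b : R) : weak_cvg_at phi l \1_(`]a, b]%classic).
Proof.
have [ba|ab] := leP b a.
  rewrite set_itv_ge ?bnd_simp -?leNgt//.
  by apply: (eq_weak_cvg_at _ (weak_cvg_at0 phi l)) => x;
    rewrite indicE in_set0.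
apply: (weak_cvg_at_lim mphi absphi);
  first exact: (integrable_indic_itv a b false false).
move=> e e0.
have /cvgrPdist_le/(_ (e / 2)) := cvg_Rintegral_cauchy_smooth ab.
rewrite divr_gt0// => /(_ isT)[N _ /(_ N (leqnn N)) hN].
have y0 : 0 < N.+1%:R^-1 :> R by rewrite invr_gt0.
exists (cauchy_smooth a b N.+1%:R^-1); first exact: weak_cvg_at_cauchy_smooth.
rewrite Rintegral_norm_cauchy_smooth// mulrC -ler_pdivlMr//.
exact: le_trans (ler_norm _) hN.
Qed.

Lemma cvg_weak_integrable (g : R -> R) : m.-integrable setT (EFin \o g) ->
  \int[m]_x (phi n x * g x) @[n --> \oo] --> l * \int[m]_x g x.
Proof.
by move=> ig; have [] := weak_cvg_at_integrable mphi absphi weak_cvg_at_itv ig.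
Qed.

End cauchy_dense.

(** * Mixing for real observables *)

Section real_mixing.
Context {R : realType}.
Local Notation m := (@lebesgue_measure R).
Local Notation T := (@boole_map R).

Lemma measurable_iter_boole n : measurable_fun [set: R] (iter n T).
Proof. exact: (measurable_iter n (@measurable_boole_map R)). Qed.

Lemma real_mixing_ge0 (F g : R -> R) (M l : R) :
  measurable_fun [set: R] F -> (forall x, 0 <= F x) -> (forall x, F x <= M) ->
  ((2 * a)^-1 * \int[m]_(x in `[(- a)%R, a]) F x) @[a --> +oo] --> l ->
  m.-integrable setT (EFin \o g) ->
  \int[m]_x (F (iter n T x) * g x) @[n --> \oo] --> l * \int[m]_x g x.
Proof.
move=> mF F0 FM Fl ig.
apply: (@cvg_weak_integrable _ (fun n x => F (iter n T x)) M) => //.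
- by move=> n; apply: (measurableT_comp mF); exact: measurable_iter_boole.
- by move=> u v v0; exact: (cvg_boole_cauchy mF F0 FM Fl).
Qed.

Lemma real_mixing_bounded (F g : R -> R) (M l : R) :
  measurable_fun [set: R] F -> (forall x, `|F x| <= M) ->
  ((2 * a)^-1 * \int[m]_(x in `[(- a)%R, a]) F x) @[a --> +oo] --> l ->
  m.-integrable setT (EFin \o g) ->
  \int[m]_x (F (iter n T x) * g x) @[n --> \oo] --> l * \int[m]_x g x.
Proof.
move=> mF FM Fl ig.
have M0 : 0 <= M by exact: le_trans (FM 0).
pose H x := F x + M.
have mH : measurable_fun [set: R] H by exact: measurable_funD.
have H0 x : 0 <= H x by have := FM x; rewrite ler_norml -lerBlDr sub0r =>
  /andP[].
have HM x : H x <= M + M by have := FM x; rewrite ler_norml lerD2r => /andP[].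
have Hl : ((2 * a)^-1 * \int[m]_(x in `[(- a)%R, a]) H x) @[a --> +oo] --> l +
  M.
  have : (2 * a)^-1 * \int[m]_(x in `[(- a)%R, a]) F x + M @[a --> +oo] --> l +
    M.
    by apply: cvgD => //; exact: cvg_cst.
  apply: cvg_trans; apply: near_eq_cvg; near=> a.
  have a0 : 0 < a by near: a; apply: nbhs_pinfty_gt; exact: num_real.
  have iM : m.-integrable `[(- a)%R, a] (EFin \o cst M).
    by apply: (integrable_bounded_itv a (M := M)) => // x; rewrite ger0_norm.
  rewrite (RintegralD _ (integrable_bounded_itv a mF FM) iM);
    last exact: measurable_itv.
  rewrite Rintegral_cst; last exact: measurable_itv.
  have mItv : m `[(- a)%R, a] = (2 * a)%:E.
    rewrite lebesgue_measure_itv/= lte_fin gt0_cp// -EFinB/= opprK.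
    by rewrite mulr2n mulrDl mul1r.
  rewrite [X in fine X]mItv/= mulrDr; congr (_ + _).
  by field; rewrite gt_eqF.
have iFn n : m.-integrable setT (EFin \o (fun x => F (iter n T x) * g x)).
  have mFn : measurable_fun [set: R] (fun x => F (iter n T x)).
    by apply: (measurableT_comp mF); exact: measurable_iter_boole.
  exact: (lebesgue_integrable_mul mFn (fun x => FM (iter n T x)) ig).
have iMg := integrableZl measurableT M ig.
have E n : \int[m]_x (F (iter n T x) * g x) =
    \int[m]_x (H (iter n T x) * g x) - M * \int[m]_x g x.
  apply/eqP; rewrite eq_sym subr_eq; apply/eqP.
  rewrite -(RintegralZl M measurableT ig) -(RintegralD measurableT (iFn n) iMg).
  by apply: eq_Rintegral => x _; rewrite mulrDl.
under eq_cvg do rewrite E.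
have -> : l * \int[m]_x g x = (l + M) * \int[m]_x g x - M * \int[m]_x g x.
  by rewrite mulrDl addrK.
by apply: cvgB; [exact: (real_mixing_ge0 mH H0 HM Hl ig)|exact: cvg_cst].
Unshelve. all: by end_near. Qed.

(** The Boole map is nonsingular: a set that is null for the Cauchy law with
    location [0] and scale [1] is null for the Lebesgue measure. *)
Lemma ae_comp_iter_boole (P : R -> Prop) n :
  {ae m, forall x, P x} -> {ae m, forall x, P (iter n T x)}.
Proof.
move=> [N [mN N0 PN]].
pose w := iter n (@boole_hp R) (0, 1).
have mind : measurable_fun [set: R] (EFin \o (\1_N : R -> R)).
  apply/measurable_EFinP; exact: (@measurable_indic _ (measurableTypeR R) R
    setT N mN).
have ind0 x : (0 <= (EFin \o (\1_N : R -> R)) x)%E by rewrite lee_fin.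
have wE := @ge0_integral_iter_boole_cauchy R n 0 1 (EFin \o \1_N) ltr01 mind
  ind0.
have i0 : (\int[m]_x ((EFin \o (\1_N : R -> R)) x *
  (cauchy_pdf w.1 w.2 x)%:E) = 0)%E.
  transitivity (\int[m]_(x in N) (cauchy_pdf w.1 w.2 x)%:E)%E.
    rewrite [RHS]integral_mkcond epatch_indic.
    by apply: eq_integral => x _; rewrite muleC.
  apply: null_set_integral => //.
  by apply: measurable_funTS; apply/measurable_EFinP;
    exact: measurable_cauchy_pdf.
have mf : measurable_fun [set: R]
    (fun x => (EFin \o (\1_N : R -> R)) (iter n T x) * (cauchy_pdf 0 1 x)%:E)%E.
  apply: emeasurable_funM; first by apply: (measurableT_comp mind);
    exact: measurable_iter_boole.
  by apply/measurable_EFinP; exact: measurable_cauchy_pdf.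
rewrite -{}wE in i0.
have /(ae_eq_integral_abs m measurableT mf) : (\int[m]_x `|(EFin \o (\1_N :
  R -> R)) (iter n T x) *
    (cauchy_pdf 0 1 x)%:E| = 0)%E.
  rewrite -[RHS]i0; apply: eq_integral => x _; rewrite gee0_abs//.
  by rewrite mule_ge0// lee_fin cauchy_pdf_ge0.
apply: filterS => x /(_ Logic.I) /=; rewrite -EFinM => -[] /eqP.
rewrite mulf_eq0 (gt_eqF (cauchy_pdf_gt0 _ _ _))// orbF indicE pnatr_eq0 eqb0
  => /negP xN.
by apply: contrapT => Px; apply: xN; rewrite inE; exact: PN.
Qed.

Lemma real_mixing_ae (F g : R -> R) (M l : R) :
  measurable_fun [set: R] F -> {ae m, forall x, `|F x| <= M} ->
  ((2 * a)^-1 * \int[m]_(x in `[(- a)%R, a]) F x) @[a --> +oo] --> l ->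
  m.-integrable setT (EFin \o g) ->
  (forall n, m.-integrable setT (EFin \o (fun x => F (iter n T x) * g x))) /\
  \int[m]_x (F (iter n T x) * g x) @[n --> \oo] --> l * \int[m]_x g x.
Proof.
move=> mF FM Fl ig.
pose H x := if `|F x| <= M then F x else 0.
have mH : measurable_fun [set: R] H.
  apply: measurable_fun_if => //.
    by apply: measurable_fun_ler => //; exact: measurableT_comp.
  exact: measurable_funTS.
have HM x : `|H x| <= `|M|.
  by rewrite /H; case: ifPn => [/le_trans->//|_]; rewrite ?normr0 ?ler_norm.
have FH : {ae m, forall x, F x = H x}.
  by apply: (@filterS _ _ (ae_filter_ringOfSetsType m) _ _ _ FM) => x;
    rewrite /H => ->.
have mFn n : measurable_fun [set: R] (fun x => F (iter n T x)).
  by apply: (measurableT_comp mF); exact: measurable_iter_boole.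
have mHn n : measurable_fun [set: R] (fun x => H (iter n T x)).
  by apply: (measurableT_comp mH); exact: measurable_iter_boole.
have mg : measurable_fun [set: R] g.
  by apply/measurable_EFinP; exact: (measurable_int m ig).
have iHn n := lebesgue_integrable_mul (mHn n) (fun x => HM (iter n T x)) ig.
have FHn n : ae_eq m setT (EFin \o (fun x => F (iter n T x) * g x))
    (EFin \o (fun x => H (iter n T x) * g x)).
  by apply: (@filterS _ _ (ae_filter_ringOfSetsType m) _ _ _
    (ae_comp_iter_boole n FH)) => x /= ->.
have mFgn n : measurable_fun [set: R] (EFin \o (fun x => F (iter n T x) * g x)).
  by apply/measurable_EFinP; exact: measurable_funM.
have mHgn n : measurable_fun [set: R] (EFin \o (fun x => H (iter n T x) * g x)).
  by apply/measurable_EFinP; exact: measurable_funM.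
split.
  move=> n; apply/integrableP; split; first exact: mFgn.
  have /integrableP[_] := iHn n; apply: le_lt_trans.
  rewrite le_eqVlt; apply/orP; left; apply/eqP; apply: ae_eq_integral => //.
  - by apply: measurableT_comp => //; exact: mFgn.
  - by apply: measurableT_comp => //; exact: mHgn.
  - by apply: (@filterS _ _ (ae_filter_ringOfSetsType m) _ _ _ (FHn n)) =>
      x + _ => ->.
have Hl : ((2 * a)^-1 * \int[m]_(x in `[(- a)%R, a]) H x) @[a --> +oo] --> l.
  apply: cvg_trans Fl; apply: near_eq_cvg; apply: nearW => a /=.
  congr (_ * fine _); apply: ae_eq_integral => //.
  - by apply: measurable_funTS; exact/measurable_EFinP.
  - by apply: measurable_funTS; exact/measurable_EFinP.
  - by apply: (@filterS _ _ (ae_filter_ringOfSetsType m) _ _ _ FH) => x /= ->.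
have := real_mixing_bounded mH HM Hl ig.
apply: cvg_trans; apply: near_eq_cvg; apply: nearW => n /=.
congr fine; apply/esym/ae_eq_integral => //.
- exact: mFgn.
- exact: mHgn.
- exact: FHn.
Qed.

End real_mixing.

(** * Complex observables *)

Local Open Scope complex_scope.

Section complex_topology.
Context {R : realType} {I : Type} {A : set_system I} {FA : Filter A}.
Implicit Types (f : I -> R[i]) (l : R[i]).

Lemma norm_Im_le (z : R[i]) : `|complex.Im z|%:C <= `|z|.
Proof.
rewrite normc_def lecR -sqrtr_sqr; apply: ler_wsqrtr.
by rewrite lerDr sqr_ge0.
Qed.

Lemma norm_le_ReDIm (z : R[i]) : `|z| <= (`|complex.Re z| + `|complex.Im z|)%:C.
Proof.
rewrite normc_def lecR -[leRHS]ger0_norm ?addr_ge0// -sqrtr_sqr;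
  apply: ler_wsqrtr.
rewrite sqrrD !real_normK ?num_real// lerD2r lerDl.
by rewrite mulrn_wge0// mulr_ge0.
Qed.

Lemma cvg_complexP f l :
  f x @[x --> A] --> l <->
  (complex.Re (f x) @[x --> A] --> complex.Re l) /\
  (complex.Im (f x) @[x --> A] --> complex.Im l).
Proof.
split=> [/cvgrPdist_le fl|[/cvgrPdist_le fr /cvgrPdist_le fi]].
- split; apply/cvgrPdist_le => e e0.
    have /fl : 0 < e%:C :> R[i] by rewrite ltcR.
    apply: filterS => x; rewrite -lecR; apply: le_trans.
    by rewrite -raddfB; exact: normc_ge_Re.
  have /fl : 0 < e%:C :> R[i] by rewrite ltcR.
  apply: filterS => x; rewrite -lecR; apply: le_trans.
  by rewrite -raddfB; exact: norm_Im_le.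
- apply/cvgrPdist_le => e; rewrite ltcE/= => /andP[/eqP eI eR].
  have e2 : 0 < complex.Re e / 2 by rewrite divr_gt0.
  near=> x.
  apply: le_trans (norm_le_ReDIm _) _; rewrite lecE/= eI eqxx/= !raddfB.
  rewrite [leRHS]splitr lerD//; near: x; [exact: fr|exact: fi].
Unshelve. all: by end_near. Qed.

End complex_topology.

Section complex_observables.
Context {R : realType}.
Local Notation m := (@lebesgue_measure R).

Lemma Re_le_normc (z : R[i]) : `|complex.Re z| <= Normc.normc z.
Proof. by rewrite -lecR; exact: normc_ge_Re. Qed.

Lemma Im_le_normc (z : R[i]) : `|complex.Im z| <= Normc.normc z.
Proof. by rewrite -lecR; exact: norm_Im_le. Qed.

Lemma measurable_normc (f : R -> R[i]) :
  measurable_fun [set: R] (fun x => complex.Re (f x)) ->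
  measurable_fun [set: R] (fun x => complex.Im (f x)) ->
  measurable_fun [set: R] (fun x => Normc.normc (f x)).
Proof.
move=> mr mi.
have -> : (fun x => Normc.normc (f x)) =
    (fun x => Num.sqrt ((complex.Re (f x)) ^+ 2 + (complex.Im (f x)) ^+ 2)).
  by apply/funext => x; case: (f x).
apply: (measurableT_comp (f := @Num.sqrt R)).
  by apply: continuous_measurable_fun => x; exact: sqrt_continuous.
by apply: measurable_funD; exact: measurable_funX.
Qed.

Lemma local_observable_integrable (g : R -> R[i]) : local_observable g ->
  m.-integrable setT (EFin \o (fun x => complex.Re (g x))) /\
  m.-integrable setT (EFin \o (fun x => complex.Im (g x))).
Proof.
move=> [mr mi]; rewrite /finite_norm Lnorm1 => ng.
have ig : m.-integrable setT (EFin \o (fun x => Normc.normc (g x))).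
  apply/integrableP; split=> //; apply/measurable_EFinP;
    exact: measurable_normc.
split; apply: le_integrable ig => //.
- exact/measurable_EFinP.
- by move=> x _ /=; rewrite lee_fin;
    apply: le_trans (Re_le_normc _) (ler_norm _).
- exact/measurable_EFinP.
- by move=> x _ /=; rewrite lee_fin;
    apply: le_trans (Im_le_normc _) (ler_norm _).
Qed.

Lemma complex_Lfun_ae_bounded (F : R -> R[i]) : complex_Lfun m +oo%E F ->
  exists M : R, {ae m, forall x, Normc.normc (F x) <= M}.
Proof.
move=> [_ _]; rewrite /finite_norm unlock.
have -> : (0 < m [set: R])%E.
  have : (m `[0%R, 1%R]%classic <= m [set: R])%E.
    by apply: le_measure => //; apply/mem_set;
      [exact: measurable_itv|exact: measurableT].
  by apply: lt_le_trans; rewrite lebesgue_measure_itv/= lte_fin ltr01 -EFinB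
    subr0 lte_fin.
move=> h; have := ess_sup_ge m (abse \o (EFin \o (fun x => Normc.normc (F x)))).
move: h; set s := ess_sup _ _; case: s => [r|//|] hr.
- move=> hs; exists r; apply: (@filterS _ _ (ae_filter_ringOfSetsType m) _ _ _
    hs) => x /=.
  by rewrite lee_fin; exact: le_trans (ler_norm _).
- move=> hs; exists 0; apply: (@filterS _ _ (ae_filter_ringOfSetsType m) _ _ _
    hs) => x /=.
  by rewrite leeNy_eq.
Qed.

End complex_observables.

Theorem theorem8 (R : realType) : global_local_mixing (@boole_map R).
Proof.
move=> F g [LF cF] lg.
have [igr igi] := local_observable_integrable lg.
have [M FM] := complex_Lfun_ae_bounded LF.
have [mFr mFi _] := LF.
have /cvg_complexP[Lr Li] : volume_average F a @[a --> +oo] -->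
  infinite_volume_average F.
  exact: cF.
set L := infinite_volume_average F in Lr Li *.
pose m := @lebesgue_measure R.
have avgr : (2 * a)^-1 * \int[m]_(x in `[(- a)%R, a]) complex.Re (F x) @[a -->
  +oo]
    --> complex.Re L.
  apply: cvg_trans Lr; apply: near_eq_cvg; apply: nearW => a.
  by rewrite /volume_average /complex_integral /= !mul0r subr0.
have avgi : (2 * a)^-1 * \int[m]_(x in `[(- a)%R, a]) complex.Im (F x) @[a -->
  +oo]
    --> complex.Im L.
  apply: cvg_trans Li; apply: near_eq_cvg; apply: nearW => a.
  by rewrite /volume_average /complex_integral /= !mul0r addr0.
have FMr : {ae m, forall x, `|complex.Re (F x)| <= M}.
  apply: (@filterS _ _ (ae_filter_ringOfSetsType m) _ _ _ FM) => x.
  exact: le_trans (Re_le_normc _).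
have FMi : {ae m, forall x, `|complex.Im (F x)| <= M}.
  apply: (@filterS _ _ (ae_filter_ringOfSetsType m) _ _ _ FM) => x.
  exact: le_trans (Im_le_normc _).
have [irr crr] := real_mixing_ae mFr FMr avgr igr.
have [iri cri] := real_mixing_ae mFr FMr avgr igi.
have [iir cir] := real_mixing_ae mFi FMi avgi igr.
have [iii cii] := real_mixing_ae mFi FMi avgi igi.
have ReM (z w : R[i]) : complex.Re (z * w) =
    complex.Re z * complex.Re w - complex.Im z * complex.Im w.
  by case: z => a b; case: w.
have ImM (z w : R[i]) : complex.Im (z * w) =
    complex.Re z * complex.Im w + complex.Im z * complex.Re w.
  by case: z => a b; case: w.
apply/cvg_complexP; split.
- rewrite ReM/=; under eq_cvg.
    move=> n; under eq_Rintegral do rewrite ReM.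
    rewrite (RintegralB measurableT (irr n) (iii n)).
    over.
  exact: cvgB.
- rewrite ImM/=; under eq_cvg.
    move=> n; under eq_Rintegral do rewrite ImM.
    rewrite (RintegralD measurableT (iri n) (iir n)).
    over.
  exact: cvgD.
Qed.
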